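(* Let $\mathfrak{g}$ be a finite-dimensional simple complex Lie algebra of type $A_r$, $B_r$, $C_r$, $D_r$, or $G_2$, with set of positive roots $\Phi^+$, and let $\mathcal{T}(\infty)$, $\operatorname{seg}(T)$ and $\mathrm{wt}(T)$ be as defined in the context. Then $$\prod_{\alpha\in\Phi^+} \frac{1-t^{-1}\boldsymbol{z}^\alpha}{1-\boldsymbol{z}^\alpha} = \sum_{T\in \mathcal{T}(\infty)} (1-t^{-1})^{\operatorname{seg}(T)}\,\boldsymbol{z}^{-\mathrm{wt}(T)}.$$
   Context: Conventions. Simple roots $\alpha_1,\dots,\alpha_r$ are numbered as in Bourbaki (in $G_2$, $\alpha_1$ is the short simple root). $Q^+=\bigoplus_i\mathbf{Z}_{\ge0}\alpha_i$ and $Q^-=-Q^+$. The identity is read as an identity of formal power series in $\boldsymbol{z}^{\alpha_1},\dots,\boldsymbol{z}^{\alpha_r}$ with coefficients in $\mathbf{Z}[t^{-1}]$, where $\boldsymbol{z}^{\mu+\nu}=\boldsymbol{z}^\mu\boldsymbol{z}^\nu$ and $1/(1-\boldsymbol{z}^\alpha)=\sum_{n\ge0}\boldsymbol{z}^{n\alpha}$. The set $\mathcal{T}(\infty)$. Alphabets: $J(A_r)=\{1\prec2\prec\cdots\prec r+1\}$; $J(B_r)=\{1\prec\cdots\prec r\prec0\prec\overline r\prec\cdots\prec\overline1\}$; $J(C_r)=\{1\prec\cdots\prec r\prec\overline r\prec\cdots\prec\overline1\}$; $J(D_r)=\{1\prec\cdots\prec r-1\prec r,\overline r\prec\overline{r-1}\prec\cdots\prec\overline1\}$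 ($r$ and $\overline r$ are incomparable); $J(G_2)=\{1\prec2\prec3\prec0\prec\overline3\prec\overline2\prec\overline1\}$. A tableau is semistandard if its entries weakly increase along rows (left to right) and strictly increase down columns. It is marginally large if, for every row $i$, the number of $i$-boxes in row $i$ exceeds the total number of boxes in row $i+1$ by exactly one (the row below the last row counts as having $0$ boxes). $\mathcal{T}(\infty)$ is the set of marginally large semistandard tableaux on $J(X_r)$ such that: - the tableau has exactly $r$ rows (types $A_r,B_r,C_r$), $r-1$ rows (type $D_r$), or $2$ rows (type $G_2$), and its first column has entries $1,2,3,\dots$ from top to bottom; - types $B_r,C_r,D_r$: every entry in row $i$ is $\preceq\overline\imath$; - type $B_r$: the entry $0$ occurs at most once in each row; - type $D_r$: the entries $r$ and $\overline r$ do not both appear in the same row; - type $G_2$: $0$ occurs at most once in the first row, and the second row is a single $2$ followed by any number of $3$'s. Write $\ell_{i,k}(T)$ for the number of $k$-boxes in row $i$ of $T$. Segments. For $k\in J(X_r)\setminus\{1\}$, a $k$-segment of $T$ is a maximal sequence of $k$-boxes in one row of $T$; the required $k$-boxes beginning row $k$ do not count as a $k$-segment. Let $\operatorname{seg}'(T)$ be the total number of segments of $T$. Then: - types $A_r,C_r$: $\operatorname{seg}(T)=\operatorname{seg}'(T)$; - type $B_r$: $\operatorname{seg}(T)=\operatorname{seg}'(T)-e_B(T)$, where $e_B(T)$ is the number of rows $i$ containing both a $0$-segment and an $\overline\imath$-segment; - type $D_r$: $\operatorname{seg}(T)=\operatorname{seg}'(T)+e_D(T)$, where $e_D(T)$ is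 the number of rows $i$ containing an $\overline\imath$-segment but neither an $r$-segment nor an $\overline r$-segment; - type $G_2$: $\operatorname{seg}(T)=\operatorname{seg}'(T)-1$ if the first row contains both a $0$-segment and a $\overline1$-segment, and $\operatorname{seg}(T)=\operatorname{seg}'(T)$ otherwise. The weight. $-\mathrm{wt}(T)\in Q^+$ is the sum over all boxes of $T$ of the following contributions (all boxes containing $i$ in row $i$ contribute $0$). For a box in row $i$: - $A_r$: $k$ ($i<k\le r+1$) contributes $\alpha_i+\cdots+\alpha_{k-1}$. - $B_r$: $k$ ($i<k\le r$) contributes $\alpha_i+\cdots+\alpha_{k-1}$; $0$ contributes $\alpha_i+\cdots+\alpha_r$; $\overline k$ ($i<k\le r$) contributes $\alpha_i+\cdots+\alpha_{k-1}+2\alpha_k+\cdots+2\alpha_r$; $\overline\imath$ contributes $2(\alpha_i+\cdots+\alpha_r)$. - $C_r$: $k$ ($i<k\le r$) contributes $\alpha_i+\cdots+\alpha_{k-1}$; $\overline k$ ($i\le k\le r$) contributes $\alpha_i+\cdots+\alpha_{r-1}+\alpha_r+\alpha_{r-1}+\cdots+\alpha_k$ (for $k=r$: $\alpha_i+\cdots+\alpha_r$). - $D_r$: $k$ ($i<k\le r-1$) contributes $\alpha_i+\cdots+\alpha_{k-1}$; $r$ contributes $\alpha_i+\cdots+\alpha_{r-2}+\alpha_{r-1}$; $\overline r$ contributes $\alpha_i+\cdots+\alpha_{r-2}+\alpha_r$; $\overline k$ ($i<k\le r-1$) contributes $\alpha_i+\cdots+\alpha_{r-1}+\alpha_r+\alpha_{r-2}+\cdots+\alpha_k$;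 $\overline\imath$ contributes $(\alpha_i+\cdots+\alpha_{r-1})+(\alpha_i+\cdots+\alpha_{r-2}+\alpha_r)$. (For $i=r-1$ the sum $\alpha_i+\cdots+\alpha_{r-2}$ is empty.) - $G_2$, first row: $2\mapsto\alpha_1$, $3\mapsto\alpha_1+\alpha_2$, $0\mapsto2\alpha_1+\alpha_2$, $\overline3\mapsto3\alpha_1+\alpha_2$, $\overline2\mapsto3\alpha_1+2\alpha_2$, $\overline1\mapsto2(2\alpha_1+\alpha_2)$; second row: $3\mapsto\alpha_2$. *)

(* Defs.v *)
From HB Require Import structures.
From mathcomp Require Import all_boot all_order all_algebra.
From mathcomp Require Import complex.
From mathcomp Require Import boolp classical_sets functions cardinality fsbigop.
From mathcomp Require Import reals.

Set Implicit Arguments.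
Unset Strict Implicit.
Unset Printing Implicit Defensive.

Import Order.TTheory GRing.Theory Num.Theory.

Local Open Scope ring_scope.

Inductive cartanType : Type :=
| TypeA of nat | TypeB of nat | TypeC of nat | TypeD of nat | TypeG2.

Definition rank (X : cartanType) : nat :=
  match X with
  | TypeA r | TypeB r | TypeC r | TypeD r => r
  | TypeG2 => 2
  end.

(* The ranges of Bourbaki's tables. *)
Definition valid_type (X : cartanType) : bool :=
  match X with
  | TypeA r => 1 <= r
  | TypeB r | TypeC r => 2 <= r
  | TypeD r => 3 <= r
  | TypeG2 => true
  end%N.

(* [cartan_entry X i j] is alpha_j(alpha_i^vee), where i and j are 1-based
   Bourbaki labels between 1 and [rank X]. *)
Definition cartan_entry (X : cartanType) (i j : nat) : int :=
  let adjacent := (i == j.+1) || (j == i.+1) in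
  if i == j then 2 else
  match X with
  | TypeA _ => if adjacent then -1 else 0
  | TypeB r =>
      if adjacent then (if (i == r) && (j.+1 == r) then - 2%:Z else -1) else 0
  | TypeC r =>
      if adjacent then (if (j == r) && (i.+1 == r) then - 2%:Z else -1) else 0
  | TypeD r =>
      if [|| (i < r) && (j < r) && adjacent,
             (i == r) && (j.+2 == r) | (j == r) && (i.+2 == r)]%N
      then -1 else 0
  | TypeG2 => if i == 1%N then - 3%:Z else -1
  end.

Record lieAlgebra (F : fieldType) : Type := LieAlgebra {
  lie_space :> vectType F;
  lie_br : lie_space -> lie_space -> lie_space;
  lie_linearl : forall y, linear (lie_br^~ y);
  lie_linearr : forall x, linear (lie_br x);
  lie_alternating : forall x, lie_br x x = 0;
  lie_jacobi : forall x y z,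
    lie_br x (lie_br y z) + lie_br y (lie_br z x) + lie_br z (lie_br x y) = 0
}.

Section LieAlgebra.
Variables (F : fieldType) (g : lieAlgebra F).

Definition simple_lie : Prop :=
  (exists x y : g, lie_br x y <> 0) /\
  forall I : {vspace g},
    (forall x y : g, y \in I -> lie_br x y \in I) ->
    I = 0%VS \/ I = fullv.

Definition ad_diagonalizable (x : g) : Prop :=
  exists2 b : seq g, basis_of fullv b &
    forall v, v \in b -> exists c : F, lie_br x v = c *: v.

(* Toral and equal to its own centralizer; for a semisimple Lie algebra over
   an algebraically closed field of characteristic 0 these are the Cartan
   subalgebras. *)
Definition cartan_subalgebra (H : {vspace g}) : Prop :=
  [/\ forall x y, x \in H -> y \in H -> lie_br x y = 0,
      forall x, x \in H -> ad_diagonalizable x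
    & forall x, (forall h, h \in H -> lie_br h x = 0) -> x \in H].

Variable H : {vspace g}.

Definition hdual : vectType F := 'Hom(subvs_of H, F^o).

Definition in_root_space (a : hdual) (x : g) : Prop :=
  forall h : subvs_of H, lie_br (vsval h) x = a h *: x.

Definition is_root (a : hdual) : Prop :=
  a != 0 /\ exists2 x : g, x != 0 & in_root_space a x.

Definition is_coroot (a : hdual) (h : subvs_of H) : Prop :=
  (exists x y : g,
     [/\ in_root_space a x, in_root_space (- a) y & vsval h = lie_br x y]) /\
  a h = 2.

End LieAlgebra.

(* The element \sum_i n_i alpha_i of Q^+ is represented by the function n; the
   ordinal i stands for the 1-based label i.+1. *)
Definition Qplus (r : nat) := {ffun 'I_r -> nat}.

Section Base.
Variables (F : fieldType) (g : lieAlgebra F) (H : {vspace g}) (r : nat).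
Variable alpha : 'I_r -> hdual H.

Definition Qplus_eval (n : Qplus r) : hdual H := \sum_i alpha i *+ n i.

Definition is_base : Prop :=
  [/\ forall i, is_root (alpha i),
      free (codom alpha)
    & forall b : hdual H, is_root b ->
        exists n : Qplus r, b = Qplus_eval n \/ b = - Qplus_eval n].

Definition has_cartan_matrix (a : nat -> nat -> int) : Prop :=
  forall i : 'I_r, exists2 h : subvs_of H, is_coroot (alpha i) h &
    forall j : 'I_r, alpha j h = (a i.+1 j.+1)%:~R.

Definition pos_roots : set (Qplus r) := [set n | is_root (Qplus_eval n)]%classic.

End Base.

(* Formal power series in r variables over Z[t^-1]; a series is the family of
   its coefficients, and Z[t^-1] is {poly int} with 'X standing for t^-1. *)
Definition tinv : {poly int} := 'X.

Definition pseries (r : nat) := Qplus r -> {poly int}.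

Section PowerSeries.
Variable r : nat.
Implicit Types (f g : pseries r) (a m : Qplus r).

(* c z^a *)
Definition psmono (c : {poly int}) a : pseries r := fun m => c *+ (m == a).

Definition psone : pseries r := psmono 1 0.

Definition pssub f g : pseries r := fun m => f m - g m.

(* The range of summation is finite. *)
Definition psmul f g : pseries r := fun m =>
  \sum_(p \in [set p : Qplus r * Qplus r | p.1 + p.2 = m]%classic) f p.1 * g p.2.

(* 1 / (1 - z^a) = \sum_(n >= 0) z^(n a), for a != 0: a term with n > \sum_i m_i
   has no coefficient at z^m. *)
Definition psgeom a : pseries r := fun m =>
  \sum_(n < (\sum_i m i)%N.+1) psmono 1 (a *+ n) m.

(* The family (f i) for i in D is summable with sum s. *)
Definition has_formal_sum (I : choiceType) (D : set I) (f : I -> pseries r)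
    (s : pseries r) : Prop :=
  forall m, finite_set [set i | D i /\ f i m != 0]%classic /\
            s m = \sum_(i \in D) f i m.

End PowerSeries.

Arguments psmono {r} c a m.
Arguments psone r m : clear implicits.
Arguments psgeom {r} a m.

Inductive letter : Type := Plain of nat | Zero | Barred of nat.

Definition letter_code (x : letter) : nat + option nat :=
  match x with
  | Plain k => inl k | Zero => inr None | Barred k => inr (Some k)
  end.

Definition letter_decode (c : nat + option nat) : letter :=
  match c with
  | inl k => Plain k | inr None => Zero | inr (Some k) => Barred k
  end.

Lemma letter_codeK : cancel letter_code letter_decode. Proof. by case. Qed.

HB.instance Definition _ := Countable.copy letter (can_type letter_codeK).

Definition in_alphabet (X : cartanType) (x : letter) : bool :=
  match X, x with
  | TypeA r, Plain k => 1 <= k <= r.+1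
  | TypeB r, (Plain k | Barred k) => 1 <= k <= r
  | TypeB r, Zero => true
  | TypeC r, (Plain k | Barred k) => 1 <= k <= r
  | TypeD r, (Plain k | Barred k) => 1 <= k <= r
  | TypeG2, (Plain k | Barred k) => 1 <= k <= 3
  | TypeG2, Zero => true
  | _, _ => false
  end%N.

Definition prec (X : cartanType) (x y : letter) : bool :=
  match x, y with
  | Plain k, Plain l => k < l
  | Plain k, Zero => true
  | Plain k, Barred l => if X is TypeD r then ~~ ((k == r) && (l == r)) else true
  | Zero, Barred _ => true
  | Barred k, Barred l => l < k
  | _, _ => false
  end%N.

Definition preceq (X : cartanType) (x y : letter) : bool :=
  (x == y) || prec X x y.

(* A tableau is the list of its rows, from top to bottom. *)
Definition tableau := seq (seq letter).

(* Rows are numbered from 1; rows outside the tableau are empty. *)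
Definition trow (T : tableau) (i : nat) : seq letter := nth [::] T i.-1.

Definition semistandard (X : cartanType) (T : tableau) : Prop :=
  [/\ all (all (in_alphabet X)) T,
      forall i, (1 <= i)%N -> (size (trow T i.+1) <= size (trow T i))%N,
      all (sorted (preceq X)) T
    & forall i j, (1 <= i)%N -> (j < size (trow T i.+1))%N ->
        prec X (nth Zero (trow T i) j) (nth Zero (trow T i.+1) j)].

Definition marginally_large (T : tableau) : Prop :=
  forall i, (1 <= i <= size T)%N ->
    count_mem (Plain i) (trow T i) = (size (trow T i.+1)).+1.

Definition nrows (X : cartanType) : nat :=
  match X with
  | TypeA r | TypeB r | TypeC r => r
  | TypeD r => r.-1
  | TypeG2 => 2
  end.

Definition type_condition (X : cartanType) (T : tableau) : Prop :=
  let bounded := forall i x, (1 <= i <= size T)%N -> x \in trow T i ->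
    preceq X x (Barred i) in
  match X with
  | TypeA _ => True
  | TypeB _ => bounded /\ forall w, w \in T -> (count_mem Zero w <= 1)%N
  | TypeC _ => bounded
  | TypeD r => bounded /\
      forall w, w \in T -> ~~ ((Plain r \in w) && (Barred r \in w))
  | TypeG2 => (count_mem Zero (trow T 1) <= 1)%N /\
      exists n, trow T 2 = Plain 2 :: nseq n (Plain 3)
  end.

Definition Tinf (X : cartanType) : set tableau :=
  [set T | [/\ semistandard X T, marginally_large T,
      size T = nrows X,
      forall i, (1 <= i <= size T)%N -> ohead (trow T i) = Some (Plain i)
    & type_condition X T]]%classic.

(* The number of maximal constant runs in row i, leaving out runs of 1 and the
   run of i that begins the row. *)
Definition row_segments (i : nat) (w : seq letter) : nat :=
  (\sum_(j < size w)
     [&& nth Zero w j != Plain 1,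
         (j == 0 :> nat) || (nth Zero w j.-1 != nth Zero w j)
       & ~~ ((j == 0 :> nat) && (nth Zero w j == Plain i))])%N.

Definition seg' (T : tableau) : nat :=
  (\sum_(1 <= i < (size T).+1) row_segments i (trow T i))%N.

Definition e_B (T : tableau) : nat :=
  (\sum_(1 <= i < (size T).+1)
     ((Zero \in trow T i) && (Barred i \in trow T i)))%N.

Definition e_D (r : nat) (T : tableau) : nat :=
  (\sum_(1 <= i < (size T).+1)
     [&& Barred i \in trow T i, Plain r \notin trow T i
       & Barred r \notin trow T i])%N.

(* The truncated subtractions are exact: a row counted in e_B contains at least
   two segments. *)
Definition seg (X : cartanType) (T : tableau) : nat :=
  match X with
  | TypeA _ | TypeC _ => seg' T
  | TypeB _ => seg' T - e_B T
  | TypeD r => seg' T + e_D r T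
  | TypeG2 => seg' T - ((Zero \in trow T 1) && (Barred 1 \in trow T 1))
  end%N.

(* alpha_i + ... + alpha_j, with 1-based labels; zero if j < i. *)
Definition asum (r i j : nat) : Qplus r :=
  [ffun k : 'I_r => nat_of_bool (i <= k.+1 <= j)%N].

(* The contribution of a box containing x in row i.  With [asum r i k.-1 = 0]
   for k <= i, a box i in row i contributes 0, and in types B, C and D the
   formulas for barred k with k > i also cover barred i. *)
Definition box_weight (X : cartanType) (i : nat) (x : letter) :
    Qplus (rank X) :=
  let s := asum (rank X) in
  match X, x with
  | TypeA r, Plain k => s i k.-1
  | TypeB r, Plain k => s i k.-1
  | TypeB r, Zero => s i r
  | TypeB r, Barred k => s i k.-1 + s k r *+ 2
  | TypeC r, Plain k => s i k.-1
  | TypeC r, Barred k => s i r + s k r.-1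
  | TypeD r, Plain k => s i k.-1
  | TypeD r, Barred k =>
      if k == r then s i r.-2 + s r r else s i r + s k r.-2
  | TypeG2, Plain 2 => if i == 1%N then s 1%N 1%N else 0
  | TypeG2, Plain 3 => if i == 1%N then s 1%N 2%N else s 2%N 2%N
  | TypeG2, Zero => s 1%N 1%N *+ 2 + s 2%N 2%N
  | TypeG2, Barred 3 => s 1%N 1%N *+ 3 + s 2%N 2%N
  | TypeG2, Barred 2 => s 1%N 1%N *+ 3 + s 2%N 2%N *+ 2
  | TypeG2, Barred 1 => (s 1%N 1%N *+ 2 + s 2%N 2%N) *+ 2
  | _, _ => 0
  end.

Definition negwt (X : cartanType) (T : tableau) : Qplus (rank X) :=
  \sum_(1 <= i < (size T).+1) \sum_(x <- trow T i) box_weight X i x.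

(* Main.v *)
Require Import Defs.
From mathcomp Require Import all_boot all_order all_algebra.
From mathcomp Require Import complex.
From mathcomp Require Import boolp classical_sets functions cardinality fsbigop.
From mathcomp Require Import reals.
From mathcomp Require Import zify ring.

Set Implicit Arguments.
Unset Strict Implicit.
Unset Printing Implicit Defensive.

Import Order.TTheory GRing.Theory Num.Theory.

Local Open Scope ring_scope.

(** Both sides are expanded as sums over multiplicity functions on the positive
roots.  Since (1 - t^-1 z^a) / (1 - z^a) = 1 + sum_(n > 0) (1 - t^-1) z^(na),
the product is the sum of (1 - t^-1)^(size of the support of c) z^(sum c(a) a)
over all c : Phi^+ -> nat.  The weights of the admissible boxes of a tableau,
apart from a box bar i in row i in types B, D and G2, are exactly the positive
roots, each obtained once; a box bar i in row i has the weight of two boxes 0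
(types B and G2) or of a box r and a box bar r (type D) and is replaced by
these.  This turns T(infinity) into the set of the functions c, and the
corrections e_B and e_D make seg(T) the size of the support of c.

The positive roots of g are found without classification results: by sl_2
theory the positive roots other than a simple root a_i are permuted by the
reflection in a_i, and any two sets of nonzero elements of Q^+ that contain the
simple roots and have this property coincide, because every nonzero element of
Q^+ is lowered by some simple reflection. *)

(** Marginal largeness is what makes the multiplicities free parameters. Row i has one more box i
    than the row below has boxes, so a tableau is recovered from the last row upwards once the
    numbers of its other letters are known. The leading boxes i of a row also reach past the end of
    the row below, so strictness down the columns imposes nothing further.

    The finiteness of the type enters only through one positivity: a suitable nonnegative
    combination of the simple coroots is positive on every simple root, hence on every nonzero
    element of Q^+, and so one of the simple coroots is positive there.

    The exponents are therefore kept as lists aligned with the given enumeration of the roots, and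
    this enumeration is lifted to one of the pairs (row, letter). *)

Lemma muln_lfunE (R : comNzRingType) (aT rT : vectType R) (f : 'Hom(aT, rT))
    n x : (f *+ n) x = f x *+ n.
Proof.
by elim: n => [|n IHn]; rewrite ?mulr0n ?zero_lfunE // !mulrS add_lfunE IHn.
Qed.

(** * Root strings of an sl_2-triple *)

Section LieAlgebraStrings.
Variables (F : numFieldType) (g : lieAlgebra F) (H : {vspace g}).
Implicit Types (x y z v : g) (a b : hdual H).

Lemma lie_brDl x y z : lie_br (x + y) z = lie_br x z + lie_br y z.
Proof. by have := lie_linearl z 1 x y; rewrite !scale1r. Qed.

Lemma lie_brDr x y z : lie_br x (y + z) = lie_br x y + lie_br x z.
Proof. by have := lie_linearr x 1 y z; rewrite !scale1r. Qed.

Lemma lie_brx0 x : lie_br x 0 = 0.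
Proof. by apply: (addrI (lie_br x 0)); rewrite -lie_brDr !addr0. Qed.

Lemma lie_br0x x : lie_br 0 x = 0.
Proof. by apply: (addrI (lie_br 0 x)); rewrite -lie_brDl !addr0. Qed.

Lemma lie_brZl c x y : lie_br (c *: x) y = c *: lie_br x y.
Proof. by have := lie_linearl y c x 0; rewrite lie_br0x !addr0. Qed.

Lemma lie_brZr c x y : lie_br x (c *: y) = c *: lie_br x y.
Proof. by have := lie_linearr x c y 0; rewrite lie_brx0 !addr0. Qed.

Lemma lie_brC x y : lie_br x y = - lie_br y x.
Proof.
have := lie_alternating (x + y).
rewrite lie_brDl !lie_brDr !lie_alternating add0r addr0 => /eqP.
by rewrite addr_eq0 => /eqP.
Qed.

Lemma lie_brNr x y : lie_br x (- y) = - lie_br x y.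
Proof. by rewrite -scaleN1r lie_brZr scaleN1r. Qed.

Lemma lie_br_sum x (I : Type) (s : seq I) (f : I -> g) :
  lie_br x (\sum_(i <- s) f i) = \sum_(i <- s) lie_br x (f i).
Proof.
elim: s => [|i s IHs]; first by rewrite !big_nil lie_brx0.
by rewrite !big_cons lie_brDr IHs.
Qed.

Lemma lie_br_deriv x y z :
  lie_br x (lie_br y z) = lie_br (lie_br x y) z + lie_br y (lie_br x z).
Proof.
have /eqP := lie_jacobi x y z; rewrite -addrA addr_eq0 => /eqP ->.
by rewrite [lie_br z x]lie_brC lie_brNr [lie_br z _]lie_brC opprD !opprK addrC.
Qed.

Lemma root_space_br a b x y :
  in_root_space a x -> in_root_space b y ->
  in_root_space (a + b) (lie_br x y).
Proof.
move=> ax bx h; rewrite lie_br_deriv ax bx lie_brZl lie_brZr -scalerDl.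
by rewrite add_lfunE.
Qed.

Lemma root_space_iter a b x y n :
  in_root_space a x -> in_root_space b y ->
  in_root_space (b + a *+ n) (iter n (lie_br x) y).
Proof.
move=> ax bx; elim: n => [|n IHn]; first by rewrite mulr0n addr0.
by rewrite mulrSr addrA addrC /=; apply: root_space_br.
Qed.

(** An eigenvector has a nonzero coordinate in the eigenbasis, and freeness forces its eigenvalue to
    be that of the corresponding basis vector. The finiteness of [cs] is what makes root strings
    stop. *)
Lemma diag_eigenvalues x :
  ad_diagonalizable x ->
  exists cs : seq F, forall c v, v != 0 -> lie_br x v = c *: v -> c \in cs.
Proof.
case=> b bP bE.
have [c cE] := choice (fun i : 'I_(size b) => bE _ (mem_nth 0 (ltn_ord i))).
exists (codom c) => c0 v v0 vE; apply: contraNT v0 => c0P.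
have bP' : basis_of fullv (in_tuple b) by [].
have vb : v = \sum_i coord (in_tuple b) i v *: b`_i.
  by rewrite {1}(coord_basis bP' (memvf v)).
have sum0 : \sum_(i < size b)
    ((c i - c0) * coord (in_tuple b) i v) *: (in_tuple b)`_i = 0.
  rewrite -[RHS](subrr (c0 *: v)) -{1}vE [in RHS]vb lie_br_sum scaler_sumr.
  rewrite -sumrB; apply: eq_bigr => i _.
  by rewrite lie_brZr cE !scalerA -scalerBl mulrBl [_ * c i]mulrC.
have /freeP freeb := basis_free bP'.
rewrite vb big1 // => i _.
have /eqP := freeb _ sum0 i; rewrite mulf_eq0 subr_eq0 => /orP[/eqP cic0|/eqP->].
  by rewrite -cic0 codom_f in c0P.
exact: scale0r.
Qed.

Section Triple.
Variables (a : hdual H) (h : subvs_of H) (e f : g).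
Hypotheses (ea : in_root_space a e) (fa : in_root_space (- a) f).
Hypotheses (hE : vsval h = lie_br e f) (ah : a h = 2).
Hypothesis diagH : ad_diagonalizable (vsval h).

(** As long as they do not vanish, the iterates are eigenvectors of ad h for the values b(h) + 2n.
    These are pairwise distinct in characteristic 0, so there cannot be more of them than entries of
    [cs]. *)
Lemma highest_vector b x :
  x != 0 -> in_root_space b x ->
  exists2 p, iter p (lie_br e) x != 0 & iter p.+1 (lie_br e) x = 0.
Proof.
move=> x0 bx; have [cs csP] := diag_eigenvalues diagH.
have n0 : exists n, iter n (lie_br e) x == 0.
  apply: contrapT => /forallNP nz.
  pose s := [seq (b + a *+ n) h | n <- iota 0 (size cs).+1].
  have us : uniq s.
    rewrite map_inj_uniq ?iota_uniq // => m n.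
    rewrite !add_lfunE => /addrI; rewrite !muln_lfunE.
    rewrite ah -!mulrnA => /eqP; rewrite eqr_nat => /eqP; lia.
  have : (size s <= size cs)%N.
    apply: uniq_leq_size us _ => _ /mapP [n _ ->].
    apply: (csP _ (iter n (lie_br e) x)); first by apply/negP/nz.
    exact: root_space_iter.
  by rewrite size_map size_iota ltnn.
case: (ex_minnP n0) => -[|p] p0 pmin.
  by rewrite p0 in x0.
exists p; last exact/eqP.
by apply/negP => /pmin; rewrite ltnn.
Qed.

(** Moving e past one f contributes the h-weight b(h) - 2k of f^k v, and these weights for k = 0,
    ..., n add up to (n+1)(b(h) - n). *)
Lemma raise_lower b v n :
  in_root_space b v -> lie_br e v = 0 ->
  lie_br e (iter n.+1 (lie_br f) v)
    = (n.+1%:R * (b h - n%:R)) *: iter n (lie_br f) v.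
Proof.
move=> bv ev.
have step k : lie_br e (iter k.+1 (lie_br f) v)
    = (b h - 2 *+ k) *: iter k (lie_br f) v
      + lie_br f (lie_br e (iter k (lie_br f) v)).
  rewrite /= lie_br_deriv -hE (root_space_iter k fa bv) add_lfunE muln_lfunE.
  by rewrite opp_lfunE ah mulNrn.
elim: n => [|n IHn]; first by rewrite step ev lie_brx0 addr0 mulr0n mul1r.
rewrite step IHn lie_brZr -scalerDl; congr (_ *: _).
rewrite -!natr1; ring.
Qed.

(** Applying e to f^(n+1) v gives back f^n v up to the factor (n+1)(m - n), which is nonzero for n <
    m. *)
Lemma lower_neq0 b v n m :
  in_root_space b v -> lie_br e v = 0 -> v != 0 -> b h = m%:R ->
  (n <= m)%N -> iter n (lie_br f) v != 0.
Proof.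
move=> bv ev v0 bm; elim: n => // n IHn nm.
apply: contraNneq (IHn (ltnW nm)) => fv0.
have := raise_lower n bv ev; rewrite fv0 lie_brx0 bm => /esym/eqP.
rewrite scaler_eq0 mulf_eq0 pnatr_eq0 subr_eq0 eqr_nat.
by rewrite (gtn_eqF nm).
Qed.

(** After p steps up to a highest vector the value at h is m + 2p, so p + m steps down are possible
    without reaching 0. The net effect is a shift by -m a. *)
Lemma string_reflection b x m :
  x != 0 -> in_root_space b x -> b h = m%:R ->
  exists2 y, y != 0 & in_root_space (b - a *+ m) y.
Proof.
move=> x0 bx bm; have [p p0 p1] := highest_vector x0 bx.
have bp := root_space_iter p ea bx.
have hp : (b + a *+ p) h = (m + p.*2)%:R.
  by rewrite add_lfunE muln_lfunE bm ah natrD -muln2 mulnC natrM mulr_natr.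
exists (iter (p + m) (lie_br f) (iter p (lie_br e) x)).
  by apply: (lower_neq0 bp _ p0 hp); [exact: p1 | lia].
have -> : b - a *+ m = (b + a *+ p) + (- a) *+ (p + m).
  by rewrite mulNrn mulrnDr opprD addrA addrK.
exact: root_space_iter.
Qed.

(* The string through a vector of weight k a would reach H, and ad e maps H
   onto multiples of e, which e kills. *)
Lemma no_multiple_root k x :
  (forall y, in_root_space (0 : hdual H) y -> y \in H) ->
  (1 < k)%N -> x != 0 -> ~ in_root_space (a *+ k) x.
Proof.
move=> H0 k1 x0 kx; have [p p0 p1] := highest_vector x0 kx.
have bp := root_space_iter p ea kx.
set v := iter p _ x in p0 bp; set q := (k + p)%N.
have hq : (a *+ k + a *+ p) h = q.*2%:R.
  by rewrite -mulrnDr muln_lfunE ah -muln2 mulnC natrM mulr_natr.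
have vq0 : iter q (lie_br f) v \in H.
  apply: H0; have := root_space_iter q fa bp.
  by rewrite -mulrnDr mulNrn subrr.
(* Since q >= 2, e can be applied twice below f^q v: the first application shows that f^(q-1) v is a
   multiple of e, and the second then equates 0 with a nonzero multiple of f^(q-2) v. *)
have [q' qE] : exists q', q = q'.+2 by exists q.-2; rewrite /q; lia.
have eq0 : lie_br e (iter q (lie_br f) v) = - a (Subvs vq0) *: e.
  by rewrite lie_brC -[iter q _ _]/(vsval (Subvs vq0)) ea scaleNr.
have := raise_lower q'.+1 bp p1; rewrite -qE eq0 hq => fq.
have := raise_lower q' bp p1; rewrite hq => fq1.
have c0 n : (n < q)%N -> n.+1%:R * (q.*2%:R - n%:R) != 0 :> F.
  move=> nq; rewrite mulf_neq0 ?pnatr_eq0 // subr_eq0 eqr_nat; lia.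
have fqe : iter q'.+1 (lie_br f) v
    = ((q%:R * (q.*2%:R - q'.+1%:R))^-1 * - a (Subvs vq0)) *: e.
  by rewrite -scalerA fq scalerK // {1}qE c0 ?qE.
move: fq1; rewrite fqe lie_brZr lie_alternating scaler0 => /esym/eqP.
rewrite scaler_eq0 (negPf (c0 _ _)) ?qE //=.
by apply/negP; apply: (lower_neq0 bp p1 p0 hq); lia.
Qed.

End Triple.
End LieAlgebraStrings.

(** * Simple reflections and the positive roots *)

Section SimpleReflections.
Variables (F : numFieldType) (g : lieAlgebra F) (H : {vspace g}) (r : nat).
Variables (alpha : 'I_r -> hdual H) (A : nat -> nat -> int).

Definition simple_elt (i : 'I_r) : Qplus r := [ffun j => nat_of_bool (j == i)].

Definition pairing (i : 'I_r) (n : Qplus r) : int :=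
  \sum_(j < r) A i.+1 j.+1 * (n j)%:Z.

(** A relation rather than a function, because the reflection of an element of Q^+ may leave Q^+. *)
Definition reflects (i : 'I_r) (n n' : Qplus r) : Prop :=
  (forall j, j != i -> n' j = n j) /\ (n' i)%:Z = (n i)%:Z - pairing i n.

Hypothesis cartH : cartan_subalgebra H.
Hypothesis baseA : is_base alpha.
Hypothesis cartA : has_cartan_matrix alpha A.

Lemma free_intr (z : 'I_r -> int) :
  \sum_i alpha i *~ z i = 0 -> forall i, z i = 0.
Proof.
case: baseA => _ freeA _ sum0 i.
have /freeP/(_ (fun k => (z (enum_val k))%:~R)) : free (codom_tuple alpha).
  exact: freeA.
move=> /(_ _ (enum_rank i)); rewrite enum_rankK => zi.
apply/eqP; rewrite -(intr_eq0 F); apply/eqP/zi.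
rewrite -[RHS]sum0 (reindex enum_rank) /=; last exact/onW_bij/enum_rank_bij.
by apply: eq_bigr => k _; rewrite enum_rankK nth_image enum_rankK scaler_int.
Qed.

Lemma Qplus_evalE (n : Qplus r) : Qplus_eval alpha n = \sum_i alpha i *~ (n i)%:Z.
Proof. by []. Qed.

Lemma Qplus_eval_simple i : Qplus_eval alpha (simple_elt i) = alpha i.
Proof.
rewrite /Qplus_eval (bigD1 i) //= ffunE eqxx big1 ?addr0 // => j /negPf ji.
by rewrite ffunE ji.
Qed.

Lemma in_H_of_zero_weight y : in_root_space (0 : hdual H) y -> y \in H.
Proof.
case: cartH => _ _ centH y0; apply: centH => h hH.
by rewrite -[h]/(vsval (Subvs hH)) y0 zero_lfunE scale0r.
Qed.

Lemma root_reflection b i (p : int) :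
  is_root b -> (forall h, is_coroot (alpha i) h ->
     (forall j, alpha j h = (A i.+1 j.+1)%:~R) -> b h = p%:~R) ->
  exists2 y, y != 0 & in_root_space (b - alpha i *~ p) y.
Proof.
case=> _ [x x0 bx] hp; have [h [[e [f [ea fa hE]]] ah] hA] := cartA i.
have {hp}bh := hp h (conj (ex_intro _ e (ex_intro _ f (And3 ea fa hE))) ah) hA.
have [_ diagH _] := cartH.
case: p => p in bh *.
  exact: (string_reflection ea fa hE ah (diagH _ (subvsP h)) x0 bx bh).
(* For a negative value the roles of e and f are exchanged: the triple (f, e, -h) belongs to the
   root -alpha_i, and b is positive on -h. *)
have fa' : in_root_space (- - alpha i) e by rewrite opprK.
have hE' : vsval (- h) = lie_br f e by rewrite linearN /= hE lie_brC opprK.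
have ah' : (- alpha i) (- h) = 2 by rewrite opp_lfunE linearN /= opprK.
have bh' : b (- h) = p.+1%:R by rewrite linearN /= bh NegzE mulrNz opprK.
have := string_reflection fa fa' hE' ah' (diagH _ (subvsP _)) x0 bx bh'.
by rewrite NegzE mulrNz mulNrn.
Qed.

(** A positive root supported at i alone is k alpha_i; k = 0 is not a root, k = 1 is excluded by
    hypothesis, and k >= 2 by [no_multiple_root]. *)
Lemma pos_root_support n i :
  pos_roots alpha n -> n <> simple_elt i -> exists2 j, j != i & n j != 0%N.
Proof.
move=> [n0 [x x0 nx]] ni; apply: contrapT => /forall2NP supp.
have nE : Qplus_eval alpha n = alpha i *+ n i.
  rewrite /Qplus_eval (bigD1 i) //= big1 ?addr0 // => j ji.
  by case: (supp j) => // /negP; rewrite negbK => /eqP ->.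
have [h [[e [f [ea fa hE]]] ah] _] := cartA i.
have [_ diagH _] := cartH.
have ni1 : n i != 1%N.
  apply: contra_notN ni => /eqP ni1; apply/ffunP => j; rewrite ffunE.
  have [->|ji] := eqVneq j i; first by [].
  by case: (supp j) => // /negP; rewrite negbK => /eqP.
have ni0 : n i != 0%N by apply: contraNneq n0 => ni0; rewrite nE ni0.
rewrite nE in nx.
apply: (no_multiple_root ea fa hE ah (diagH _ (subvsP h)) _ _ x0 nx).
  exact: in_H_of_zero_weight.
by case: (n i) ni0 ni1 => [|[]].
Qed.

(** The reflection changes only the coordinate i. A positive coordinate at some j != i survives,
    which keeps the image nonzero and prevents it from being the negative of an element of Q^+. *)
Lemma pos_roots_reflect n i :
  pos_roots alpha n -> n <> simple_elt i ->
  exists2 n', pos_roots alpha n' & reflects i n n'.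
Proof.
move=> nP ni; have [j ji nj0] := pos_root_support nP ni.
have [||y y0 ny] := @root_reflection (Qplus_eval alpha n) i (pairing i n).
- exact: nP.
- move=> h _ hA; rewrite Qplus_evalE sum_lfunE /pairing rmorph_sum /=.
  by apply: eq_bigr => k _; rewrite muln_lfunE hA rmorphM /= mulr_natr.
set c := _ - _ in ny.
pose z k : int := (n k)%:Z - (pairing i n) *+ (k == i).
have cE : c = \sum_k alpha k *~ z k.
  rewrite /c Qplus_evalE (bigD1 i) //= [RHS](bigD1 i) //= addrAC; congr (_ + _).
    by rewrite /z eqxx mulrzBr.
  by apply: eq_bigr => k /negPf ki; rewrite /z ki subr0.
have zj : z j = (n j)%:Z by rewrite /z (negPf ji) subr0.
have croot : is_root c.
  split; last by exists y.
  apply/eqP; rewrite cE => /free_intr/(_ j); rewrite zj => -[nj].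
  by rewrite nj in nj0.
have [_ _ /(_ _ croot)[n' [cn'|cn']]] := baseA.
  exists n'; first by rewrite /pos_roots /= -cn'.
  have nz k : (n' k)%:Z = z k.
    apply/eqP; rewrite -subr_eq0; apply/eqP.
    apply: (@free_intr (fun k => (n' k)%:Z - z k)).
    under eq_bigr do rewrite mulrzBr.
    by rewrite sumrB -cE -Qplus_evalE cn' subrr.
  split=> [k /negPf ki|]; last by rewrite nz /z eqxx.
  by have := nz k; rewrite /z ki subr0 => -[].
have : z j + (n' j)%:Z = 0.
  apply: (@free_intr (fun k => z k + (n' k)%:Z)).
  under eq_bigr do rewrite mulrzDr.
  by rewrite big_split /= -cE -Qplus_evalE cn' addNr.
rewrite zj; lia.
Qed.

Lemma simple_pos_root i : pos_roots alpha (simple_elt i).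
Proof. by rewrite /pos_roots /= Qplus_eval_simple; case: baseA. Qed.

Lemma pos_root_neq0 n : pos_roots alpha n -> n != 0.
Proof.
case=> n0 _; apply: contraNneq n0 => ->.
by rewrite /Qplus_eval big1 // => i _; rewrite ffunE.
Qed.

End SimpleReflections.

(* By induction on the height, which some simple reflection lowers. *)
Lemma reflection_closed_sub r (A : nat -> nat -> int) (P E : set (Qplus r)) :
  (forall i, A i.+1 i.+1 = 2) ->
  (forall n : Qplus r, n != 0 -> exists i, 0 < pairing A i n) ->
  (forall n, P n -> n != 0) ->
  (forall n i, P n -> n <> simple_elt i -> exists2 n', P n' & reflects A i n n') ->
  (forall i, E (simple_elt i)) ->
  (forall n i, E n -> n <> simple_elt i -> exists2 n', E n' & reflects A i n n') ->
  (P `<=` E)%classic.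
Proof.
move=> diagA posA P0 Pr E1 Er n.
have [k] := ubnP (\sum_i n i)%N; elim: k n => // k IHk n nk nP.
have [[i ->]|nsimple] := pselect (exists i, n = simple_elt i); first exact: E1.
have [i ni] := posA n (P0 _ nP).
have [n' nP' [nj' ni']] := Pr n i nP (fun e => nsimple (ex_intro _ i e)).
have nE' : E n'.
  apply: IHk nP'; move: nk.
  have sumE m : (\sum_j m j = m i + \sum_(j < r | j != i) m j)%N by exact: bigD1.
  have restE : (\sum_(j < r | j != i) n' j = \sum_(j < r | j != i) n j)%N.
    by apply: eq_bigr => j /nj'.
  by rewrite !sumE restE; lia.
have pn' : pairing A i n' = - pairing A i n.
  rewrite /pairing (bigD1 i) //= [X in - X](bigD1 i) //= ni'.
  rewrite (eq_bigr (fun j : 'I_r => A i.+1 j.+1 * (n j)%:Z)) => [|j ji].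
    by rewrite /pairing (bigD1 i) //= diagA; ring.
  by rewrite nj'.
(* This licenses reflecting [n'] back inside [E]: [n'] pairs negatively with i, whereas alpha_i
   pairs to 2. *)
have ns' : n' <> simple_elt i.
  have simple2 : pairing A i (simple_elt i) = 2.
    rewrite /pairing (bigD1 i) //= ffunE eqxx diagA big1 ?addr0 // => j ji.
    by rewrite ffunE (negPf ji) mulr0.
  move=> n'E; move: pn'; rewrite n'E simple2; lia.
have [n'' nE'' [nj'' ni'']] := Er n' i nE' ns'.
suff -> : n = n'' by [].
apply/ffunP => j; have [->|ji] := eqVneq j i; last by rewrite nj'' // nj'.
by move: ni''; rewrite pn' ni' opprK subrK => -[->].
Qed.

(** * Formal power series and summable families of monomials *)

Lemma finite_uniq_seq (T : choiceType) (A : set T) : finite_set A ->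
  exists2 l : seq T, uniq l & forall x, x \in l <-> A x.
Proof.
case/finite_seqP => l ->; exists (undup l); first exact: undup_uniq.
by move=> x; rewrite mem_undup.
Qed.

Section FormalSums.
Variable r : nat.
Implicit Types (f g : pseries r) (a b m : Qplus r).

Lemma Qplus_addE a b i : (a + b) i = (a i + b i)%N.
Proof. by rewrite ffunE. Qed.

Lemma Qplus_mulnE a k i : (a *+ k) i = (k * a i)%N.
Proof.
by elim: k => [|k IHk]; rewrite ?mulr0n ?ffunE // mulrS Qplus_addE IHk mulSn.
Qed.

Lemma Qplus_addI a : injective (+%R a).
Proof.
by move=> b c /ffunP e; apply/ffunP => i; have := e i; rewrite !Qplus_addE => /addnI.
Qed.

Lemma Qplus_mulnI a : a != 0 -> injective (GRing.natmul a).
Proof.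
move=> a0 k l /ffunP e; apply/eqP; apply: contraNT a0 => kl.
apply/eqP/ffunP => i; have := e i; rewrite !Qplus_mulnE ffunE.
by move/eqP; rewrite eqn_mul2r (negPf kl) orbF => /eqP.
Qed.

Lemma finite_decomp m :
  finite_set [set p : Qplus r * Qplus r | p.1 + p.2 = m]%classic.
Proof.
pose N := (\sum_i m i)%N.
pose B := [set n : Qplus r | forall i, (n i <= N)%N]%classic.
have finB : finite_set B.
  apply: (@sub_finite_set _ _ ((fun h : {ffun 'I_r -> 'I_N.+1} =>
      [ffun i => h i : nat] : Qplus r) @` setT)%classic).
    move=> n nB /=; exists [ffun i => inord (n i)] => //.
    by apply/ffunP => i; rewrite !ffunE inordK // ltnS.
  exact/finite_image/finite_finset.
apply: (@sub_finite_set _ _ (B `*` B)%classic); last exact: finite_setX.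
have mN i : (m i <= N)%N by rewrite /N (bigD1 i) //= leq_addr.
move=> p /= pm; split=> i; apply: leq_trans (mN i);
  by rewrite -pm Qplus_addE ?leq_addr ?leq_addl.
Qed.

Lemma psmulE f g m : exists l : seq (Qplus r * Qplus r),
  [/\ uniq l, forall p, (p \in l) = (p.1 + p.2 == m)
    & psmul f g m = \sum_(p <- l) f p.1 * g p.2].
Proof.
have [l ul lP] := finite_uniq_seq (finite_decomp m); exists l; split=> //.
  by move=> p; apply/idP/eqP => [/lP|/lP].
by apply: fsbig_fwiden => // p => [/lP|[/lP pS []]].
Qed.

(** The list may contain indices whose term vanishes at m, so it can be chosen for convenience
    instead of being the exact support. *)
Lemma has_formal_sumP (I : choiceType) (D : set I) (f : I -> pseries r) s :
  has_formal_sum D f s <-> forall m, exists l : seq I,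
    [/\ uniq l, forall i, i \in l -> D i,
        forall i, D i -> f i m != 0 -> i \in l & s m = \sum_(i <- l) f i m].
Proof.
have sumE l m : uniq l -> (forall i, i \in l -> D i) ->
    (forall i, D i -> f i m != 0 -> i \in l) ->
    \sum_(i \in D) f i m = \sum_(i <- l) f i m.
  move=> ul lD fl; rewrite (fsbigE l) //; last first.
    by move=> i Di il; apply/eqP; apply: contraNT il; apply: fl.
  rewrite big_seq_cond [RHS]big_seq; apply: eq_bigl => i.
  by apply: andb_idr => /lD Di; rewrite inE.
split=> [fs m|fs m].
  have [fin ->] := fs m; have [l ul lP] := finite_uniq_seq fin.
  have lD i : i \in l -> D i by move/lP => [].
  have fl i : D i -> f i m != 0 -> i \in l by move=> Di fi; apply/lP.
  by exists l; split=> //; apply: sumE.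
have [l [ul lD fl ->]] := fs m; split; last by rewrite (sumE l m).
by apply: sub_finite_set (finite_seq l) => i /= [Di]; apply: fl.
Qed.

Lemma psmul_formal_sum (I J : choiceType) (D : set I) (D' : set J)
    (u : I -> {poly int}) (v : J -> {poly int}) (a : I -> Qplus r)
    (b : J -> Qplus r) f g :
  has_formal_sum D (fun i => psmono (u i) (a i)) f ->
  has_formal_sum D' (fun j => psmono (v j) (b j)) g ->
  has_formal_sum (D `*` D')%classic
    (fun p => psmono (u p.1 * v p.2) (a p.1 + b p.2)) (psmul f g).
Proof.
move=> /has_formal_sumP/choice[lf lfP] /has_formal_sumP/choice[lg lgP].
apply/has_formal_sumP => m; have [l [ul lP ->]] := psmulE f g m.
(* [lf p] may contain indices whose monomial is not z^p. Once they are filtered out, a pair (i, j)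
   arises from the single decomposition (a i, b j) of m, which keeps [L] free of duplicates. *)
pose lf' p := [seq i <- lf p | a i == p].
pose lg' q := [seq j <- lg q | b j == q].
have fE p : f p = \sum_(i <- lf' p) u i.
  have [_ _ _ ->] := lfP p; rewrite big_filter [RHS]big_mkcond /=.
  by apply: eq_bigr => i _; rewrite /psmono eq_sym; case: eqP.
have gE q : g q = \sum_(j <- lg' q) v j.
  have [_ _ _ ->] := lgP q; rewrite big_filter [RHS]big_mkcond /=.
  by apply: eq_bigr => i _; rewrite /psmono eq_sym; case: eqP.
pose L := [seq q | p <- l, q <- [seq (i, j) | i <- lf' p.1, j <- lg' p.2]].
have LP q : (q \in L) = [&& q.1 \in lf (a q.1), q.2 \in lg (b q.2)
                         & a q.1 + b q.2 == m].
  apply/allpairsPdep/and3P => [[p [_ [pl /allpairsP[[i j] /= [ip jp ->]] ->]]]|].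
    move: ip jp; rewrite !mem_filter /= => /andP[/eqP -> ->] /andP[/eqP -> ->].
    by rewrite -lP.
  case: q => i j /= [il jl ijm]; exists (a i, b j), (i, j); split=> //.
    by rewrite lP.
  by apply/allpairsP; exists (i, j); rewrite !mem_filter /= !eqxx.
exists L; split.
- apply: allpairs_uniq_dep => //.
  + move=> p _; apply: allpairs_uniq; last by move=> [? ?] [? ?] _ _ [-> ->].
      by apply: filter_uniq; case: (lfP p.1).
    by apply: filter_uniq; case: (lgP p.2).
  + move=> [p q] [p' q'] /allpairsPdep[x [y [_ yP [-> ->]]]].
    move=> /allpairsPdep[x' [y' [_ yP' [-> ->]]]] /= yy'.
    move: yP yP'; rewrite -yy' => /allpairsP[[i j] /= [ip jp ->]].
    case/allpairsP => [[i' j'] /= [ip' jp' [ii jj]]].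
    rewrite -ii -jj !mem_filter in ip jp ip' jp'.
    suff -> : x = x' by [].
    case: x x' ip jp ip' jp' => [x1 x2] [x1' x2'] /=.
    by move=> /andP[/eqP <- _] /andP[/eqP <- _] /andP[/eqP <- _] /andP[/eqP <- _].
- move=> [i j]; rewrite LP /= => /and3P[il jl _].
  by have [_ lD _ _] := lfP (a i); have [_ lD' _ _] := lgP (b j);
    split; [apply: lD | apply: lD'].
- move=> [i j] [/= Di Dj]; rewrite /psmono LP /=.
  case: (m =P _) => [->|_]; last by rewrite eqxx.
  rewrite mulr1n mulf_eq0 negb_or eqxx andbT => /andP[u0 v0].
  have [_ _ fl _] := lfP (a i); have [_ _ gl _] := lgP (b j).
  by rewrite fl ?gl // /psmono eqxx.
- rewrite big_allpairs_dep /= big_seq [RHS]big_seq; apply: eq_bigr => p.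
  rewrite lP => /eqP pm; rewrite fE gE big_distrlr /= big_allpairs_dep /=.
  rewrite big_seq [RHS]big_seq; apply: eq_bigr => i ip.
  rewrite big_seq [RHS]big_seq; apply: eq_bigr => j jp.
  move: ip jp; rewrite !mem_filter /psmono => /andP[/eqP -> _] /andP[/eqP -> _].
  by rewrite pm eqxx.
Qed.

Lemma psgeom_mulrn a n : a != 0 -> psgeom a (a *+ n) = 1.
Proof.
move=> a0; have [i ai] : exists i, (0 < a i)%N.
  apply: contrapT => /forallNP ai; case/eqP: a0; apply/ffunP => i.
  by rewrite ffunE; have := ai i; case: (a i).
(* The truncation in [psgeom] keeps the exponent n, because a has a coordinate at least 1. *)
have nle : (n < (\sum_j (a *+ n) j).+1)%N.
  rewrite ltnS (bigD1 i) //= Qplus_mulnE.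
  by apply: leq_trans (leq_addr _ _); rewrite leq_pmulr.
rewrite /psgeom (bigD1 (Ordinal nle)) //= /psmono eqxx big1 ?addr0 // => k kn.
case: eqP => // /(Qplus_mulnI a0) nk; case/eqP: kn; exact: val_inj.
Qed.

Lemma psgeom_eq0 a m : (forall n, m != a *+ n) -> psgeom a m = 0.
Proof. by move=> ma; apply: big1 => n _; rewrite /psmono (negPf (ma n)). Qed.

Lemma psmul_subl f f' g m : psmul (pssub f f') g m = psmul f g m - psmul f' g m.
Proof.
have lP := finite_uniq_seq (finite_decomp m); case: lP => l ul lP.
have E h : psmul h g m = \sum_(p <- l) h p.1 * g p.2.
  by apply: fsbig_fwiden => // p => [/lP|[/lP pS []]].
by rewrite !E -sumrB; apply: eq_bigr => p _; rewrite mulrBl.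
Qed.

Lemma psmul_mono c b g q : psmul (psmono c b) g (b + q) = c * g q.
Proof.
have [l [ul lP ->]] := psmulE (psmono c b) g (b + q).
rewrite (bigD1_seq (b, q)) ?lP //= /psmono eqxx big_seq_cond big1 ?addr0 //.
move=> [p p'] /=; rewrite lP /=; case: (eqVneq p b) => [-> |]; last by rewrite mul0r.
by move=> /andP[/eqP/Qplus_addI ->]; rewrite eqxx.
Qed.

Lemma psmul_mono_eq0 c b g m :
  (forall q, m != b + q) -> psmul (psmono c b) g m = 0.
Proof.
move=> mb; have [l [ul lP ->]] := psmulE (psmono c b) g m.
rewrite big_seq big1 // => p; rewrite lP /psmono => /eqP pm.
by case: eqP => [pb|_]; [have := mb p.2; rewrite -pb pm eqxx | rewrite mul0r].
Qed.

Lemma factor_formal_sum a : a != 0 ->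
  has_formal_sum [set: nat] (fun n => psmono ((1 - tinv) ^+ (n != 0%N)) (a *+ n))
    (psmul (pssub (psone _) (psmono tinv a)) (psgeom a)).
Proof.
move=> a0; apply/has_formal_sumP => m.
have E1 : psmul (psone r) (psgeom a) m = psgeom a m.
  by rewrite -{1}[m]add0r psmul_mono mul1r.
rewrite psmul_subl {}E1.
have [[n ->]|mn] := pselect (exists n, m = a *+ n).
  exists [:: n]; split=> // [i _|].
    rewrite /psmono; case: (a *+ n =P _) => [/(Qplus_mulnI a0) ->|].
      by rewrite mem_head.
    by rewrite eqxx.
  rewrite big_seq1 psgeom_mulrn // /psmono eqxx mulr1n.
  case: n => [|n]; last by rewrite mulrS psmul_mono psgeom_mulrn // mulr1.
  rewrite psmul_mono_eq0 ?subr0 // => q; apply: contraNneq a0 => /ffunP e.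
  apply/eqP/ffunP => i; have := e i; rewrite Qplus_addE !ffunE.
  by case: (a i).
exists [::]; split=> // [n _|].
  rewrite /psmono; case: (m =P _) => [mE|]; last by rewrite eqxx.
  by case: mn; exists n.
rewrite big_nil psgeom_eq0 ?sub0r; last first.
  by move=> n; apply/eqP => mE; apply: mn; exists n.
have [[q mE]|mq] := pselect (exists q, m = a + q).
  rewrite mE psmul_mono psgeom_eq0 ?mulr0 ?oppr0 // => n.
  by apply/eqP => qE; apply: mn; exists n.+1; rewrite mE qE mulrS.
rewrite psmul_mono_eq0 ?oppr0 // => q.
by apply/eqP => mE; apply: mq; exists q.
Qed.

Lemma has_formal_sum_bij (I J : choiceType) (D : set I) (E : set J) (h : I -> J)
    (f : J -> pseries r) s :
  set_bij D E h -> has_formal_sum E f s -> has_formal_sum D (f \o h) s.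
Proof.
move=> hbij fs m; have [fin ->] := fs m; split; last exact: reindex_fsbig.
case: hbij => hsub hinj _.
rewrite -(@eq_finite_set _ _ (h @` [set i | D i /\ (f \o h) i m != 0])%classic).
  by apply: sub_finite_set fin => _ [i [Di fi] <-]; split=> //; apply: hsub.
apply: inj_card_eq => x y; rewrite !inE => -[Dx _] [Dy _].
by apply: hinj; rewrite inE.
Qed.

(** The exponents form a list aligned with [s], so the product is unfolded factor by factor in the
    given order, with no algebraic law for [psmul]. *)
Lemma prod_factor_formal_sum (s : seq (Qplus r)) : all (predC1 0) s ->
  has_formal_sum [set c : seq nat | size c = size s]%classic
    (fun c => psmono ((1 - tinv) ^+ count (predC1 0%N) c)
                     (\sum_(p <- zip c s) p.2 *+ p.1))
    (\big[@psmul r / psone r]_(a <- s)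
       psmul (pssub (psone _) (psmono tinv a)) (psgeom a)).
Proof.
elim: s => [_|a s IHs /= /andP[a0 /IHs{}IHs]].
  apply/has_formal_sumP => m; exists [:: [::]]; split=> //.
  - by move=> i; rewrite inE => /eqP ->.
  - by move=> [].
  - by rewrite big_nil big_seq1 /= big_nil.
rewrite big_cons.
have := psmul_formal_sum (factor_formal_sum a0) IHs.
set P := psmul _ _ => PP.
have bij : set_bij [set c : seq nat | size c = (size s).+1]%classic
    ([set: nat] `*` [set c | size c = size s])%classic
    (fun c => (head 0%N c, behead c)).
  split.
  - by move=> [] //= n c [cs].
  - by move=> [|n c] [|n' c']; rewrite !inE //= => _ _ [-> ->].
  - by move=> [n c] /= [_ cs]; exists (n :: c) => //=; rewrite cs.
apply/has_formal_sumP => m.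
have /has_formal_sumP/(_ m)[l [ul lD fl sE]] := has_formal_sum_bij bij PP.
have fE c : size c = (size s).+1 ->
    psmono ((1 - tinv) ^+ count (predC1 0%N) c)
      (\sum_(p <- zip c (a :: s)) p.2 *+ p.1) m =
    psmono ((1 - tinv) ^+ (head 0%N c != 0%N) *
            (1 - tinv) ^+ count (predC1 0%N) (behead c))
      (a *+ head 0%N c + \sum_(p <- zip (behead c) s) p.2 *+ p.1) m.
  by case: c => //= n c _; rewrite big_cons exprD.
exists l; split=> // [c cs|]; first by rewrite fE //; apply: fl.
by rewrite sE big_seq [RHS]big_seq; apply: eq_bigr => c /lD; move=> cs; rewrite fE.
Qed.

End FormalSums.

(** * The boxes that carry positive roots *)

(** Listed in increasing order, so that repeating the letters in place yields a sorted row. In type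
    D the incomparable letters r and bar r are listed in this order by convention. *)
Definition base_letters (X : cartanType) (i : nat) : seq letter :=
  let plain r := [seq Plain k | k <- iota i.+1 (r - i)] in
  let barred k0 r := rev [seq Barred k | k <- iota k0 (r.+1 - k0)] in
  match X with
  | TypeA r => plain r.+1
  | TypeB r => plain r ++ Zero :: barred i.+1 r
  | TypeC r => plain r ++ barred i r
  | TypeD r => plain r ++ barred i.+1 r
  | TypeG2 => if i == 1%N then [:: Plain 2; Plain 3; Zero; Barred 3; Barred 2]
              else [:: Plain 3]
  end.

Definition root_index (X : cartanType) : seq (nat * letter) :=
  [seq (i, x) | i <- iota 1 (nrows X), x <- base_letters X i].

Definition is_root_index (X : cartanType) (i : nat) (x : letter) : bool :=
  match X, x with
  | TypeA r, Plain k => [&& 1 <= i, i < k & k <= r.+1]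
  | TypeB r, (Plain k | Barred k) => [&& 1 <= i, i < k & k <= r]
  | TypeB r, Zero => 1 <= i <= r
  | TypeC r, Plain k => [&& 1 <= i, i < k & k <= r]
  | TypeC r, Barred k => [&& 1 <= i, i <= k & k <= r]
  | TypeD r, (Plain k | Barred k) => [&& 1 <= i, i < k & k <= r]
  | TypeG2, Plain k => (i == 1) && (k == 2) || (0 < i <= 2) && (k == 3)
  | TypeG2, Zero => i == 1
  | TypeG2, Barred k => (i == 1) && (2 <= k <= 3)
  | _, _ => false
  end%N.

Lemma plain_inj : injective Plain. Proof. by move=> ? ? []. Qed.
Lemma barred_inj : injective Barred. Proof. by move=> ? ? []. Qed.

Lemma mem_Plain k (s : seq nat) : (Plain k \in [seq Plain k | k <- s]) = (k \in s).
Proof. exact/mem_map/plain_inj. Qed.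

Lemma mem_Barred k (s : seq nat) : (Barred k \in [seq Barred k | k <- s]) = (k \in s).
Proof. exact/mem_map/barred_inj. Qed.

Lemma Plain_notin_barred k s : (Plain k \in [seq Barred k | k <- s]) = false.
Proof. by apply/mapP => -[]. Qed.

Lemma Barred_notin_plain k s : (Barred k \in [seq Plain k | k <- s]) = false.
Proof. by apply/mapP => -[]. Qed.

Lemma Zero_notin_plain s : (Zero \in [seq Plain k | k <- s]) = false.
Proof. by apply/mapP => -[]. Qed.

Lemma Zero_notin_barred s : (Zero \in [seq Barred k | k <- s]) = false.
Proof. by apply/mapP => -[]. Qed.

Definition mem_letters := (mem_cat, in_cons, mem_rev, mem_Plain, mem_Barred,
  Plain_notin_barred, Barred_notin_plain, Zero_notin_plain, Zero_notin_barred,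
  mem_iota).

Lemma mem_root_index X i x : ((i, x) \in root_index X) = is_root_index X i x.
Proof.
have -> : ((i, x) \in root_index X)
    = (1 <= i < 1 + nrows X)%N && (x \in base_letters X i).
  rewrite -mem_iota; apply/allpairsPdep/andP => [[j [y [? ? [-> ->]]]] //|[? ?]].
  by exists i, x.
have PE k l : (Plain k == Plain l) = (k == l) by exact/inj_eq/plain_inj.
have BE k l : (Barred k == Barred l) = (k == l) by exact/inj_eq/barred_inj.
have ZP k : (Zero == Plain k) = false by [].
have ZB k : (Zero == Barred k) = false by [].
have PZ k : (Plain k == Zero) = false by [].
have BZ k : (Barred k == Zero) = false by [].
have PB k l : (Plain k == Barred l) = false by [].
have BP k l : (Barred k == Plain l) = false by [].
case: X => [r|r|r|r|] /=; case: x => [k||k];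
  rewrite ?mem_letters /= ?(ZP, ZB, PZ, BZ, PB, BP, eqxx) //=; try lia.
- by case: (i =P 1%N) => [->|]; rewrite !inE ?PE ?PB ?PZ; lia.
- by case: (i =P 1%N) => [->|]; rewrite !inE ?ZP ?ZB ?eqxx; lia.
- by case: (i =P 1%N) => [->|]; rewrite !inE ?BE ?BP ?BZ; lia.
Qed.

(** Defined at every natural label, so that the labels m - 1 and m + 1 can be used at the ends of
    the diagram; for the boxes carrying roots the values outside the diagram are 0. *)
Definition box_coef (X : cartanType) (i : nat) (x : letter) (p : nat) : nat :=
  match X, x with
  | TypeA r, Plain k => i <= p < k
  | TypeB r, Plain k => i <= p < k
  | TypeB r, Zero => i <= p <= r
  | TypeB r, Barred k => (i <= p < k) + 2 * (k <= p <= r)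
  | TypeC r, Plain k => i <= p < k
  | TypeC r, Barred k => (i <= p <= r) + (k <= p < r)
  | TypeD r, Plain k => i <= p < k
  | TypeD r, Barred k =>
      if k == r then (i <= p <= r.-2) + (p == r)
      else (i <= p <= r) + (k <= p <= r.-2)
  | TypeG2, Plain 2 => (i == 1) * (p == 1)
  | TypeG2, Plain 3 => (i == 1) * (p == 1) + (p == 2)
  | TypeG2, Zero => 2 * (p == 1) + (p == 2)
  | TypeG2, Barred 3 => 3 * (p == 1) + (p == 2)
  | TypeG2, Barred 2 => 3 * (p == 1) + 2 * (p == 2)
  | TypeG2, Barred 1 => 4 * (p == 1) + 2 * (p == 2)
  | _, _ => 0
  end%N.

Lemma box_weightE X i x (j : 'I_(rank X)) :
  box_weight X i x j = box_coef X i x j.+1.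
Proof.
case: X j => [r|r|r|r|] /= j; case: x => [k||k];
  rewrite ?ffunE ?Qplus_addE ?Qplus_mulnE ?ffunE //; try lia.
- by case: (k == r); rewrite ?Qplus_addE ?ffunE; lia.
- case: k => [|[|[|[|k]]]]; rewrite ?ffunE //; case: eqP => _; rewrite ?ffunE //; lia.
- case: k => [|[|[|[|k]]]]; rewrite ?ffunE ?Qplus_addE ?Qplus_mulnE ?ffunE //;
    rewrite ?Qplus_mulnE ?ffunE; lia.
Qed.

Ltac split_ifs :=
  repeat match goal with
  | |- context [if ?b then _ else _] =>
    case: (boolP b) => ? //=; try by exfalso; lia
  end.

(** * Cartan matrices, and the positive roots as box weights *)

Lemma sum_ord_support r (s : seq nat) (f : nat -> int) :
  uniq s -> (forall p, (1 <= p <= r)%N -> p \notin s -> f p = 0) ->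
  (forall p, p \in s -> ~~ (1 <= p <= r)%N -> f p = 0) ->
  \sum_(j < r) f j.+1 = \sum_(p <- s) f p.
Proof.
move=> us f0 fout; transitivity (\sum_(1 <= p < r.+1) f p).
  by rewrite big_add1 /= big_mkord.
rewrite /= (bigID (mem s)) /= [X in _ + X]big_nat_cond
  [X in _ + X]big1 ?addr0; last first.
  by move=> p /andP[pr ps]; apply: f0.
rewrite [RHS](bigID (fun p => 1 <= p <= r)%N) /=.
rewrite [X in _ = _ + X]big_seq_cond [X in _ = _ + X]big1 ?addr0; last first.
  by move=> p /andP[]; apply: fout.
rewrite -big_filter -[RHS]big_filter; apply: perm_big; apply: uniq_perm.
- by rewrite filter_uniq ?iota_uniq.
- by rewrite filter_uniq.
- by move=> p; rewrite !mem_filter mem_index_iota andbC ltnS.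
Qed.

(** The combination of the simple coroots with coefficients [u] is positive on each simple root,
    hence on [n]. As the coefficients are nonnegative, the simple coroots cannot all be nonpositive
    on [n]. *)
Lemma exists_pos_pairing r (A : nat -> nat -> int) (u : nat -> int) :
  (forall i, (1 <= i <= r)%N -> 0 <= u i) ->
  (forall j, (1 <= j <= r)%N -> 0 < \sum_(i < r) u i.+1 * A i.+1 j) ->
  forall n : Qplus r, n != 0 -> exists i, 0 < pairing A i n.
Proof.
move=> u0 uA n n0; apply: contrapT => /forallNP npos.
have [j nj] : exists j, (0 < n j)%N.
  apply: contrapT => /forallNP nz; case/eqP: n0; apply/ffunP => i.
  by rewrite ffunE; have := nz i; case: (n i).
have : \sum_(i < r) u i.+1 * pairing A i n <= 0.
  apply: sumr_le0 => i _; apply: mulr_ge0_le0; first by apply: u0; exact: ltn_ord.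
  by rewrite leNgt; apply/negP/npos.
under eq_bigr do rewrite mulr_sumr.
rewrite exchange_big /= leNgt => /negP[].
have colE k : \sum_(i < r) u i.+1 * (A i.+1 (k : 'I_r).+1 * (n k)%:Z)
    = (\sum_(i < r) u i.+1 * A i.+1 k.+1) * (n k)%:Z.
  by rewrite mulr_suml; apply: eq_bigr => i _; rewrite mulrA.
rewrite (bigD1 j) //= ltr_wpDr //.
  apply: sumr_ge0 => k _; rewrite colE mulr_ge0 // ltW //.
  by apply: uA; exact: ltn_ord.
by rewrite colE mulr_gt0 ?uA ?ltz_nat ?ltn_ord.
Qed.

(* Proportional to the coordinates of the sum of the positive coroots. *)
Definition coroot_sum (X : cartanType) (i : nat) : int :=
  match X with
  | TypeA r => i%:Z * (r.+1%:Z - i%:Z)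
  | TypeB r => if i == r then r%:Z * r.+1%:Z else 2 * i%:Z * (r.*2.+1%:Z - i%:Z)
  | TypeC r => i%:Z * (r.*2%:Z - i%:Z)
  | TypeD r => if (r.-1 <= i)%N then r%:Z * r.-1%:Z
               else 2 * i%:Z * (r.*2.-1%:Z - i%:Z)
  | TypeG2 => if i == 1%N then 3 else 5
  end.

(* The label m and those adjacent to it in the Dynkin diagram; labels outside
   the diagram may be included. *)
Definition neighbours (X : cartanType) (m : nat) : seq nat :=
  match X with
  | TypeD r =>
    if m == r then [:: r.-2; r] else if m == r.-1 then [:: r.-2; r.-1]
    else if m == r.-2 then [:: r.-2.-1; r.-2; r.-1; r]
    else [:: m.-1; m; m.+1]
  | TypeG2 => [:: 1; 2]%N
  | _ => [:: m.-1; m; m.+1]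
  end.

Lemma neighbours_uniq X m : valid_type X -> (1 <= m <= rank X)%N ->
  uniq (neighbours X m).
Proof.
case: X => [r|r|r|r|] //= Xr mr; rewrite ?inE; try lia.
by do 3 (case: eqP => ?; first by rewrite /= ?inE; lia); rewrite /= ?inE; lia.
Qed.

Lemma cartan_entry_far X m p : valid_type X -> (1 <= m <= rank X)%N ->
  (1 <= p <= rank X)%N -> p \notin neighbours X m ->
  cartan_entry X m p = 0 /\ cartan_entry X p m = 0.
Proof.
rewrite /cartan_entry; case: X => [r|r|r|r|] //= Xr mr pr.
- by rewrite !inE => pm; rewrite !ifF //; lia.
- by rewrite !inE => pm; rewrite !ifF //; lia.
- by rewrite !inE => pm; rewrite !ifF //; lia.
- by do 3 (case: eqP => ?; first by rewrite !inE => pm; rewrite !ifF //; lia);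
    rewrite !inE => pm; rewrite !ifF //; lia.
- by rewrite !inE; lia.
Qed.

Lemma cartan_row_sum X m (f : nat -> int) :
  valid_type X -> (1 <= m <= rank X)%N ->
  (forall p, ~~ (1 <= p <= rank X)%N -> f p = 0) ->
  \sum_(j < rank X) cartan_entry X m j.+1 * f j.+1
    = \sum_(p <- neighbours X m) cartan_entry X m p * f p.
Proof.
move=> Xr mr f0.
rewrite (sum_ord_support (f := fun p => cartan_entry X m p * f p)
  (s := neighbours X m)) //.
- exact: neighbours_uniq.
- by move=> p pr pm; have [-> _] := cartan_entry_far Xr mr pr pm; rewrite mul0r.
- by move=> p _ pr; rewrite f0 ?mulr0.
Qed.

Lemma cartan_col_sum X m (f : nat -> int) :
  valid_type X -> (1 <= m <= rank X)%N ->
  \sum_(i < rank X) f i.+1 * cartan_entry X i.+1 m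
    = \sum_(p <- neighbours X m | (1 <= p <= rank X)%N) f p * cartan_entry X p m.
Proof.
move=> Xr mr; rewrite [RHS]big_mkcond /=.
rewrite -(sum_ord_support (r := rank X)
  (f := fun p => if (1 <= p <= rank X)%N then f p * cartan_entry X p m else 0)).
- by apply: eq_bigr => i _; rewrite ifT // ltn_ord.
- exact: neighbours_uniq.
- by move=> p pr pm; have [_ ->] := cartan_entry_far Xr mr pr pm; rewrite mulr0 if_same.
- by move=> p _ /negPf ->.
Qed.

Lemma cartan_pos_pairing X (n : Qplus (rank X)) :
  valid_type X -> n != 0 -> exists i, 0 < pairing (cartan_entry X) i n.
Proof.
move=> Xr; apply: (@exists_pos_pairing _ _ (coroot_sum X)) => [i ir|j jr].
  by case: X Xr ir {n} => [r|r|r|r|] /= Xr ir; try case: ifP => ?; nia.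
rewrite cartan_col_sum //.
case: X Xr jr {n} => [r|r|r|r|] /= Xr jr.
- rewrite !big_cons big_nil /= /cartan_entry; split_ifs; nia.
- rewrite !big_cons big_nil /= /cartan_entry; split_ifs; nia.
- rewrite !big_cons big_nil /= /cartan_entry; split_ifs; nia.
- do 3 (case: eqP => [?|?];
    first by subst j; rewrite !big_cons big_nil /= /cartan_entry; split_ifs; nia).
  by rewrite !big_cons big_nil /= /cartan_entry; split_ifs; nia.
- rewrite !big_cons big_nil /= /cartan_entry; split_ifs; nia.
Qed.

Definition box_roots (X : cartanType) : set (Qplus (rank X)) :=
  [set n | exists i x, is_root_index X i x /\ n = box_weight X i x]%classic.
Arguments box_roots : clear implicits.

Lemma box_coef_out X i x p : is_root_index X i x -> ~~ (1 <= p <= rank X)%N ->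
  box_coef X i x p = 0%N.
Proof.
case: X x => [r|r|r|r|] [k||k] //=; try lia.
- by case: ifP => _; lia.
- by case: k => [|[|[|[|k]]]] //; lia.
- by case: k => [|[|[|[|k]]]] //; lia.
Qed.

Definition box_pairing X i x m : int :=
  \sum_(p <- neighbours X m) cartan_entry X m p * (box_coef X i x p)%:Z.

Lemma pairing_box X i x (m : 'I_(rank X)) : valid_type X ->
  is_root_index X i x ->
  pairing (cartan_entry X) m (box_weight X i x) = box_pairing X i x m.+1.
Proof.
move=> Xr ix; rewrite /box_pairing.
rewrite -(cartan_row_sum (f := fun p => (box_coef X i x p)%:Z)) //.
- by apply: eq_bigr => j _; rewrite box_weightE.
- exact: ltn_ord.
- by move=> p pr; rewrite box_coef_out.
Qed.

(* Coefficients outside the diagram vanish, so the ends of the diagram need no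
   separate treatment. *)
Lemma box_pairingE X i x m : valid_type X -> (1 <= m <= rank X)%N ->
  is_root_index X i x -> let c p := (box_coef X i x p)%:Z in
  box_pairing X i x m =
  match X with
  | TypeA _ => 2 * c m - c m.-1 - c m.+1
  | TypeB r => if m == r then 2 * c m - 2 * c m.-1 else 2 * c m - c m.-1 - c m.+1
  | TypeC r => if m.+1 == r then 2 * c m - c m.-1 - 2 * c m.+1
               else 2 * c m - c m.-1 - c m.+1
  | TypeD r => if m == r then 2 * c r - c r.-2
               else if m == r.-1 then 2 * c r.-1 - c r.-2
               else if m == r.-2 then 2 * c m - c m.-1 - c r.-1 - c r
               else 2 * c m - c m.-1 - c m.+1
  | TypeG2 => if m == 1%N then 2 * c 1%N - 3 * c 2%N else 2 * c 2%N - c 1%N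
  end.
Proof.
move=> Xr mr ix c; have c0 : c 0%N = 0 by rewrite /c box_coef_out.
have cr : c (rank X).+1 = 0 by rewrite /c box_coef_out // ltnn.
transitivity (\sum_(p <- neighbours X m) cartan_entry X m p * c p) => //.
clearbody c; clear ix.
have cm : m = rank X -> c m.+1 = 0 by move=> ->.
have cm1 : m = 1%N -> c m.-1 = 0 by move=> ->.
rewrite /cartan_entry; case: X Xr mr cr cm => [r|r|r|r|] //= Xr mr cr cm.
- rewrite !big_cons big_nil; split_ifs; lia.
- rewrite !big_cons big_nil; split_ifs; lia.
- rewrite !big_cons big_nil; split_ifs; lia.
- do 3 (case: eqP => [?|?];
    first by subst m; rewrite !big_cons big_nil; split_ifs; lia).
  by rewrite !big_cons big_nil; split_ifs; lia.
- rewrite !big_cons big_nil; split_ifs; lia.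
Qed.

Definition box_reflects X i x m i' x' : Prop :=
  is_root_index X i' x' /\ forall p, (1 <= p <= rank X)%N ->
    (box_coef X i' x' p)%:Z = (box_coef X i x p)%:Z - box_pairing X i x m *+ (p == m).

(** In the usual coordinates e_1, e_2, ... of types A to D, the letters k, 0 and bar k in row i
    carry e_i - e_k, e_i and e_i + e_k. For m < r, and for every m in type A, the reflection s_m
    exchanges e_m and e_(m+1). *)
Definition swap_label m k := if k == m then m.+1 else if k == m.+1 then m else k.

Ltac solve_reflects m :=
  split; [rewrite /swap_label; split_ifs; lia |
    let p := fresh "p" in
    move=> p ?; rewrite box_pairingE //= /swap_label;
    case: (p =P m) => [->|?]; rewrite ?mulr1n ?mulr0n ?subr0; split_ifs; lia].

(** The second alternative is the simple root alpha_m, the only one that s_m makes negative. In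
    types A to D the image is read off in the coordinates e_i; in G_2 the six roots are checked one
    by one. *)
Lemma box_reflection X i x m : valid_type X -> (1 <= m <= rank X)%N ->
  is_root_index X i x ->
  (exists i' x', box_reflects X i x m i' x') \/
  (forall p, (1 <= p <= rank X)%N -> box_coef X i x p = (p == m)).
Proof.
rewrite /box_reflects.
case: X => [r|r|r|r|] //= Xr mr.
- case: x => // k ik.
  have [im|im] := boolP ((i == m) && (k == m.+1)); first by right=> p pr; lia.
  by left; exists (swap_label m i), (Plain (swap_label m k)); solve_reflects m.
- have [mE|mr'] := eqVneq m r; last first.
    case: x => [k||k] ik.
    + have [im|im] := boolP ((i == m) && (k == m.+1)); first by right=> p pr; lia.
      by left; exists (swap_label m i), (Plain (swap_label m k)); solve_reflects m.
    + by left; exists (swap_label m i), Zero; solve_reflects m.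
    (* The root e_m + e_(m+1) is fixed; exchanging its labels would break the condition i < k. *)
    + left; have [im|im] := boolP ((i == m) && (k == m.+1)).
        by exists i, (Barred k); solve_reflects m.
      by exists (swap_label m i), (Barred (swap_label m k)); solve_reflects m.
  (* In type B, s_r changes the sign of e_r, so it exchanges the letters r and bar r and fixes e_i
     for i < r. *)
  subst m; case: x => [k||k] ik.
  + left; have [kr|kr] := eqVneq k r.
      by exists i, (Barred k); solve_reflects r.
    by exists i, (Plain k); solve_reflects r.
  + have [ir|ir] := eqVneq i r; first by right=> p pr; lia.
    by left; exists i, Zero; solve_reflects r.
  + left; have [kr|kr] := eqVneq k r.
      by exists i, (Plain k); solve_reflects r.
    by exists i, (Barred k); solve_reflects r.
- have [mE|mr'] := eqVneq m r; last first.
    case: x => [k||k] // ik.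
    + have [im|im] := boolP ((i == m) && (k == m.+1)); first by right=> p pr; lia.
      by left; exists (swap_label m i), (Plain (swap_label m k)); solve_reflects m.
    + left; have [im|im] := boolP ((i == m) && (k == m.+1)).
        by exists i, (Barred k); solve_reflects m.
      by exists (swap_label m i), (Barred (swap_label m k)); solve_reflects m.
  (* The sign of e_r changes here too; the simple root 2 e_r is the box bar r in row r. *)
  subst m; case: x => [k||k] // ik.
  + left; have [kr|kr] := eqVneq k r.
      by exists i, (Barred k); solve_reflects r.
    by exists i, (Plain k); solve_reflects r.
  + have [ir|ir] := eqVneq i r; first by right=> p pr; lia.
    left; have [kr|kr] := eqVneq k r.
      by exists i, (Plain k); solve_reflects r.
    by exists i, (Barred k); solve_reflects r.
- have [mE|mr'] := eqVneq m r; last first.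
    case: x => [k||k] // ik.
    + have [im|im] := boolP ((i == m) && (k == m.+1)); first by right=> p pr; lia.
      by left; exists (swap_label m i), (Plain (swap_label m k)); solve_reflects m.
    + left; have [im|im] := boolP ((i == m) && (k == m.+1)).
        by exists i, (Barred k); solve_reflects m.
      have [im'|im'] := eqVneq i m.
        by subst i; exists m.+1, (Barred k); solve_reflects m.
      have [im1|im1] := eqVneq i m.+1.
        by subst i; exists m, (Barred k); solve_reflects m.
      have [km|km] := eqVneq k m.
        by subst k; exists i, (Barred m.+1); solve_reflects m.
      have [km1|km1] := eqVneq k m.+1.
        by subst k; exists i, (Barred m); solve_reflects m.
      have [kr|kr] := eqVneq k r.
        by subst k; exists i, (Barred r); solve_reflects m.
      have [mr2|mr2] := eqVneq m r.-1.
        by subst m; exists i, (Barred k); solve_reflects r.-1.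
      by exists i, (Barred k); case: (ltnP k m) => ?; case: (ltnP i m) => ?;
        solve_reflects m.
  (* In type D, s_r maps e_(r-1) to -e_r and e_r to -e_(r-1): it exchanges r-1 with bar r, and r
     with the barred r-1, except that e_(r-1) - e_r and e_(r-1) + e_r are respectively fixed and
     simple. *)
  subst m; case: x => [k||k] // ik.
  + left; have [kr|kr] := eqVneq k r.-1.
      by exists i, (Barred r); solve_reflects r.
    have [kr'|kr'] := boolP ((k == r) && (i < r.-1)%N).
      by exists i, (Barred r.-1); solve_reflects r.
    by exists i, (Plain k); solve_reflects r.
  + have [kr|kr] := eqVneq k r.
      have [ir|ir] := eqVneq i r.-1; first by right=> p pr; lia.
      by left; exists i, (Plain r.-1); solve_reflects r.
    left; have [kr'|kr'] := eqVneq k r.-1.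
      by exists i, (Plain r); solve_reflects r.
    by exists i, (Barred k); solve_reflects r.
- have {}mr : m = 1%N \/ m = 2%N by lia.
  move=> ix.
  have : (i, x) \in root_index TypeG2 by rewrite mem_root_index.
  rewrite !inE => /orP[/eqP|/orP[/eqP|/orP[/eqP|/orP[/eqP|/orP[/eqP|/eqP]]]]] [-> ->];
    case: mr => ->.
  + by right=> p; lia.
  + by left; exists 1%N, (Plain 3); solve_reflects 2%N.
  + by left; exists 1%N, Zero; solve_reflects 1%N.
  + by left; exists 1%N, (Plain 2); solve_reflects 2%N.
  + by left; exists 1%N, (Plain 3); solve_reflects 1%N.
  + by left; exists 1%N, Zero; solve_reflects 2%N.
  + by left; exists 2%N, (Plain 3); solve_reflects 1%N.
  + by left; exists 1%N, (Barred 2); solve_reflects 2%N.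
  + by left; exists 1%N, (Barred 2); solve_reflects 1%N.
  + by left; exists 1%N, (Barred 3); solve_reflects 2%N.
  + by left; exists 1%N, (Barred 3); solve_reflects 1%N.
  + by right=> p; lia.
Qed.

Lemma box_weight_simple X i x (m : 'I_(rank X)) :
  (forall p, (1 <= p <= rank X)%N -> box_coef X i x p = (p == m.+1)) ->
  box_weight X i x = simple_elt m.
Proof.
move=> c; apply/ffunP => j; rewrite box_weightE ffunE c ?ltn_ord //.
Qed.

Lemma box_root_simple X i x (m : 'I_(rank X)) : is_root_index X i x ->
  (forall p, (1 <= p <= rank X)%N -> box_coef X i x p = (p == m.+1)) ->
  box_roots X (simple_elt m).
Proof. by move=> ix c; exists i, x; split=> //; apply/esym/box_weight_simple. Qed.

Lemma simple_box_root X (m : 'I_(rank X)) : valid_type X ->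
  box_roots X (simple_elt m).
Proof.
case: X m => [r|r|r|r|] /= m Xr; have mr := ltn_ord m.
- by apply: (@box_root_simple (TypeA r) m.+1 (Plain m.+2)) => /= *; lia.
- have [mE|mr'] := boolP (m.+1 == r).
    by apply: (@box_root_simple (TypeB r) m.+1 Zero) => /= *; lia.
  by apply: (@box_root_simple (TypeB r) m.+1 (Plain m.+2)) => /= *; lia.
- have [mE|mr'] := boolP (m.+1 == r).
    by apply: (@box_root_simple (TypeC r) m.+1 (Barred r)) => /= *; lia.
  by apply: (@box_root_simple (TypeC r) m.+1 (Plain m.+2)) => /= *; lia.
- rewrite /= in Xr; have [mE|mr'] := boolP (m.+1 == r).
    by apply: (@box_root_simple (TypeD r) r.-1 (Barred r)) => /= *;
      rewrite ?eqxx; lia.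
  by apply: (@box_root_simple (TypeD r) m.+1 (Plain m.+2)) => /= *; lia.
- have [mE|mE] := boolP (m == 0%N :> nat).
    by apply: (@box_root_simple TypeG2 1 (Plain 2)) => //= *; lia.
  by apply: (@box_root_simple TypeG2 2 (Plain 3)) => //= *; lia.
Qed.

Lemma box_roots_reflect X n (m : 'I_(rank X)) : valid_type X ->
  box_roots X n -> n <> simple_elt m ->
  exists2 n', box_roots X n' & reflects (cartan_entry X) m n n'.
Proof.
move=> Xr [i [x [ix ->]]] nm.
have mr : (1 <= m.+1 <= rank X)%N by exact: ltn_ord.
case: (box_reflection Xr mr ix) => [[i' [x' [ix' c']]]|c]; last first.
  by case: nm; apply: box_weight_simple.
exists (box_weight X i' x'); first by exists i', x'.
split=> [j jm|]; last first.
  by rewrite !box_weightE c' // eqxx mulr1n pairing_box.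
have := c' j.+1 (ltn_ord j); rewrite -!box_weightE eqSS.
by rewrite (negPf jm : (j == m :> nat) = false) mulr0n subr0 => -[].
Qed.

(** In types B, C and D the coordinate at r separates plain letters, 0 and barred letters as far as
    these share a row alphabet; the coordinates at the row numbers and at the labels of the letters,
    where the supports begin or jump, settle the rest. *)
Lemma box_weight_inj X i x i' x' :
  is_root_index X i x -> is_root_index X i' x' ->
  box_weight X i x = box_weight X i' x' -> (i, x) = (i', x').
Proof.
move=> ix ix' e.
have {e}c p : box_coef X i x p = box_coef X i' x' p.
  have [pr|pr] := boolP (1 <= p <= rank X)%N; last by rewrite !box_coef_out.
  case: p pr => // p pr; have := congr1 (fun n : Qplus _ => n (Ordinal pr)) e.
  by rewrite !box_weightE.
case: X ix ix' c => [r|r|r|r|] ix ix' c.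
- case: x x' ix ix' c => [k||k] [k'||k'] //= ix ix' c.
  by congr (_, Plain _); move: (c i) (c i') (c k.-1) (c k'.-1); lia.
- have /= ci := c i; have /= ci' := c i'.
  case: x x' ix ix' c ci ci' => [k||k] [k'||k'] //= ix ix' c ci ci';
    have ii : i = i' by [lia]; subst i' => {ci'}; try by move: (c r); lia.
  + by congr (_, Plain _); move: (c k) (c k'); lia.
  + by [].
  + by congr (_, Barred _); move: (c k) (c k'); lia.
- have /= ci := c i; have /= ci' := c i'.
  case: x x' ix ix' c ci ci' => [k||k] [k'||k'] //= ix ix' c ci ci';
    have ii : i = i' by [lia]; subst i' => {ci'}; try by move: (c r); lia.
  + by congr (_, Plain _); move: (c k) (c k'); lia.
  + by congr (_, Barred _); move: (c k) (c k'); lia.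
- have /= cr := c r.
  case: x x' ix ix' c cr => [k||k] [k'||k'] //= ix ix' c cr.
  + case: (ltngtP i i') => ii; [by move: (c i); lia|by move: (c i'); lia|].
    case: (ltngtP k k') => kk; [by move: (c k); lia|by move: (c k'); lia|].
    by rewrite ii kk.
  + by move: cr; case: ifP; lia.
  + by move: cr; case: ifP; lia.
  + move=> {cr}; case: (ltngtP i i') => ii.
    * by move: (c i); do 2 case: ifP; lia.
    * by move: (c i'); do 2 case: ifP; lia.
    subst i'; case: (ltngtP k k') => kk.
    * by move: (c k); do 2 case: ifP; lia.
    * by move: (c k'); do 2 case: ifP; lia.
    * by rewrite kk.
- rewrite -!mem_root_index !inE in ix ix'.
  have := c 1%N; have := c 2%N; move: ix ix' {c}.
  do 5 (case/orP => [/eqP[-> ->]|]; first by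
   case/orP => [|/orP[|/orP[|/orP[|/orP[|]]]]] /eqP[-> ->]).
  by case/eqP=> -> ->; case/orP => [|/orP[|/orP[|/orP[|/orP[|]]]]] /eqP[-> ->].
Qed.

Lemma box_root_neq0 X i x : is_root_index X i x -> box_weight X i x != 0.
Proof.
move=> ix; have [p [pr cp]] : exists p, (1 <= p <= rank X)%N /\ box_coef X i x p != 0%N.
  case: X ix => [r|r|r|r|] ix; last first.
    move: ix; rewrite -mem_root_index !inE.
    by case/orP => [|/orP[|/orP[|/orP[|/orP[|]]]]] /eqP[-> ->];
      first [by exists 1%N | by exists 2%N].
  - by case: x ix => [k||k] //=; [exists i | exists r]; try case: ifP; lia.
  - by case: x ix => [k||k] //=; exists i; lia.
  - by case: x ix => [k||k] //=; exists i; lia.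
  - by case: x ix => [k||k] //=; exists i; lia.
case: p pr cp => // p pr; rewrite -(box_weightE i x (Ordinal pr)).
by apply: contraNneq => ->; rewrite ffunE.
Qed.

Lemma pos_rootsE (F : numFieldType) (g : lieAlgebra F) (H : {vspace g})
    (X : cartanType) (alpha : 'I_(rank X) -> hdual H) :
  valid_type X -> cartan_subalgebra H -> is_base alpha ->
  has_cartan_matrix alpha (cartan_entry X) ->
  pos_roots alpha = box_roots X.
Proof.
move=> Xr cartH baseA cartA.
have diag i : cartan_entry X i i = 2 by rewrite /cartan_entry eqxx.
apply/seteqP; split; apply: (@reflection_closed_sub _ (cartan_entry X)) => //.
- by move=> n; apply: cartan_pos_pairing.
- exact: pos_root_neq0.
- by move=> n i; apply: pos_roots_reflect.
- by move=> i; apply: simple_box_root.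
- by move=> n i; apply: box_roots_reflect.
- by move=> n; apply: cartan_pos_pairing.
- by move=> n [i [x [ix ->]]]; apply: box_root_neq0.
- by move=> n i; apply: box_roots_reflect.
- exact: simple_pos_root.
- by move=> n i; apply: pos_roots_reflect.
Qed.

(** * Rows as sorted words determined by their letter counts *)

(* Where [has_redundant] holds, a box bar i in row i has the weight of
   [absorbed X] copies of each letter of [absorbing X i]. *)
Definition has_redundant (X : cartanType) (i : nat) : bool :=
  match X with
  | TypeB _ | TypeD _ => true
  | TypeG2 => i == 1%N
  | _ => false
  end.

Definition absorbing (X : cartanType) (i : nat) : seq letter :=
  match X with
  | TypeB _ => [:: Zero]
  | TypeD r => [:: Plain r; Barred r]
  | TypeG2 => if i == 1%N then [:: Zero] else [::]
  | _ => [::]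
  end.

Definition absorbed (X : cartanType) : nat := if X is TypeD _ then 1 else 2.

(** Where it is redundant, bar i is the greatest letter allowed in row i, so appending it keeps the
    list increasing. *)
Definition row_letters (X : cartanType) (i : nat) : seq letter :=
  base_letters X i ++ if has_redundant X i then [:: Barred i] else [::].

Lemma eq_Plain k l : (Plain k == Plain l) = (k == l).
Proof. exact/inj_eq/plain_inj. Qed.

Lemma eq_Barred k l : (Barred k == Barred l) = (k == l).
Proof. exact/inj_eq/barred_inj. Qed.

Lemma Plain_neq_Barred k l : (Plain k == Barred l) = false. Proof. by []. Qed.
Lemma Barred_neq_Plain k l : (Barred k == Plain l) = false. Proof. by []. Qed.
Lemma Plain_neq_Zero k : (Plain k == Zero) = false. Proof. by []. Qed.
Lemma Zero_neq_Plain k : (Zero == Plain k) = false. Proof. by []. Qed.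
Lemma Barred_neq_Zero k : (Barred k == Zero) = false. Proof. by []. Qed.
Lemma Zero_neq_Barred k : (Zero == Barred k) = false. Proof. by []. Qed.

Definition eq_letters := (eq_Plain, eq_Barred, Plain_neq_Barred,
  Barred_neq_Plain, Plain_neq_Zero, Zero_neq_Plain, Barred_neq_Zero,
  Zero_neq_Barred).

Definition in_row (X : cartanType) (i : nat) (x : letter) : bool :=
  match X, x with
  | TypeA r, Plain k => (i < k) && (k <= r.+1)
  | TypeB r, Plain k => (i < k) && (k <= r)
  | TypeB r, Zero => true
  | (TypeB r | TypeC r | TypeD r), Barred k => (i <= k) && (k <= r)
  | (TypeC r | TypeD r), Plain k => (i < k) && (k <= r)
  | TypeG2, Plain k => (i == 1) && (k == 2) || (k == 3)
  | TypeG2, Zero => i == 1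
  | TypeG2, Barred k => (i == 1) && (1 <= k <= 3)
  | _, _ => false
  end%N.

Lemma mem_base_letters X i x : (1 <= i <= nrows X)%N ->
  (x \in base_letters X i) = is_root_index X i x.
Proof.
move=> ir; rewrite -mem_root_index; apply/idP/allpairsPdep => [xi|].
  by exists i, x; rewrite mem_iota add1n ltnS.
by case=> j [y [_ yj [-> ->]]].
Qed.

Lemma mem_row_letters X i x : valid_type X -> (1 <= i <= nrows X)%N ->
  (x \in row_letters X i) = in_row X i x.
Proof.
move=> Xr ir; rewrite mem_cat mem_base_letters //.
case: X Xr ir => [r|r|r|r|] /= Xr ir; case: x => [k||k] //=;
  try case: (i =P 1%N) => [->|?]; rewrite ?inE ?eq_letters ?orbF //=; lia.
Qed.

Lemma redundant_notin_base X i : (1 <= i <= nrows X)%N ->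
  has_redundant X i -> Barred i \notin base_letters X i.
Proof.
move=> ir red; rewrite mem_base_letters //.
by case: X ir red => [r|r|r|r|] //= ir red; lia.
Qed.

(** The index [TypeA 0] serves to obtain a linear order on all letters at once. It extends every
    [preceq X], and in type D it only adds r before bar r. *)
Definition tle : rel letter := preceq (TypeA 0).

Lemma tleE x y : tle x y =
  match x, y with
  | Plain k, Plain l => k <= l
  | Barred k, Barred l => l <= k
  | Plain _, _ | Zero, Zero | Zero, Barred _ => true
  | _, _ => false
  end%N.
Proof.
by case: x y => [k||k] [l||l]; rewrite /tle /preceq /= ?eq_letters //; lia.
Qed.

Lemma tle_refl : reflexive tle. Proof. by move=> x; rewrite /tle /preceq eqxx. Qed.

Lemma tle_trans : transitive tle.
Proof. by move=> [k||k] [l||l] [m||m]; rewrite !tleE //; lia. Qed.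

Lemma tle_anti : antisymmetric tle.
Proof.
by move=> [k||k] [l||l]; rewrite !tleE //= => kl; congr (_ _); lia.
Qed.

Lemma preceq_tle X x y : preceq X x y -> tle x y.
Proof.
rewrite tleE /preceq => /orP[/eqP->|]; first by case: y.
by case: x y => [k||k] [l||l] //=; lia.
Qed.

Lemma tle_preceq X x y : tle x y ->
  (forall r, X = TypeD r -> ~ (x = Plain r /\ y = Barred r)) -> preceq X x y.
Proof.
rewrite /tle /preceq => /orP[->//|].
case: x y => [k||k] [l||l] //= kl D; rewrite ?eq_letters ?kl ?orbT //.
case: X D => //= r /(_ r erefl) D; apply/negP => /andP[/eqP ? /eqP ?].
by subst k l; apply: D.
Qed.

Lemma pairwise_flatten_nseq (T : eqType) (le : rel T) (s : seq T) (c : T -> nat) :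
  reflexive le -> pairwise le s -> pairwise le (flatten [seq nseq (c x) x | x <- s]).
Proof.
move=> lexx; elim: s => //= x s IHs /andP[/allP xs /IHs{}IHs].
rewrite pairwise_cat IHs andbT; apply/andP; split.
  apply/allrelP => y z; rewrite mem_nseq => /andP[_ /eqP->].
  move=> /flattenP[_ /mapP[w ws ->]]; rewrite mem_nseq => /andP[_ /eqP->].
  exact: xs.
by elim: (c x) => //= n ->; rewrite all_nseq lexx orbT.
Qed.

Lemma count_flatten_nseq (T : eqType) (s : seq T) (c : T -> nat) y : uniq s ->
  count_mem y (flatten [seq nseq (c x) x | x <- s]) = ((y \in s) * c y)%N.
Proof.
elim: s => //= x s IHs /andP[xs us]; rewrite count_cat IHs // count_nseq inE /=.
rewrite [x == y]eq_sym; case: (eqVneq y x) => [->|_] //=.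
by rewrite (negPf xs) addn0.
Qed.

Lemma sorted_plain a n : pairwise tle [seq Plain k | k <- iota a n].
Proof.
rewrite -sorted_pairwise; last exact: tle_trans.
rewrite sorted_map; apply: sub_sorted (iota_sorted a n) => x y /=.
by rewrite tleE.
Qed.

Lemma sorted_barred a n : pairwise tle (rev [seq Barred k | k <- iota a n]).
Proof.
rewrite -sorted_pairwise; last exact: tle_trans.
rewrite rev_sorted sorted_map; apply: sub_sorted (iota_sorted a n) => x y /=.
by rewrite tleE.
Qed.

Lemma row_letters_sorted X i : valid_type X -> (1 <= i <= nrows X)%N ->
  pairwise tle (Plain i :: row_letters X i).
Proof.
move=> Xr ir; rewrite pairwise_cons; apply/andP; split.
  apply/allP => x; rewrite mem_row_letters // tleE.
  by case: X x Xr ir => [r|r|r|r|] [k||k] //= Xr ir; lia.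
rewrite pairwise_cat; apply/and3P; split; last by case: has_redundant.
  apply/allrelP => x y; rewrite mem_base_letters //.
  case: ifP => // red; rewrite inE => xb /eqP ->; rewrite tleE.
  by case: X x Xr ir red xb => [r|r|r|r|] [k||k] //= Xr ir red; lia.
have PB s t : allrel tle [seq Plain k | k <- s] (rev [seq Barred k | k <- t]).
  by apply/allrelP => _ y /mapP[k _ ->]; rewrite mem_rev => /mapP[l _ ->].
case: X {Xr ir} => [r|r|r|r|]; rewrite /base_letters.
- exact: sorted_plain.
- rewrite pairwise_cat sorted_plain allrel_consr PB /= sorted_barred !andbT.
  apply/andP; split; first by rewrite all_map; apply/allP.
  by apply/allP => x; rewrite mem_rev => /mapP[k _ ->].
- by rewrite pairwise_cat sorted_plain PB sorted_barred.
- by rewrite pairwise_cat sorted_plain PB sorted_barred.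
- by case: (i == 1%N).
Qed.

Lemma base_letters_uniq X i : uniq (base_letters X i).
Proof.
have up n m : uniq [seq Plain k | k <- iota n m].
  by rewrite map_inj_uniq ?iota_uniq //; apply: plain_inj.
have ub n m : uniq (rev [seq Barred k | k <- iota n m]).
  by rewrite rev_uniq map_inj_uniq ?iota_uniq //; apply: barred_inj.
have PB s t : ~~ has [in [seq Plain k | k <- s]] (rev [seq Barred k | k <- t]).
  by apply/hasPn => x; rewrite mem_rev => /mapP[k _ ->]; rewrite /= Barred_notin_plain.
case: X => [r|r|r|r|]; rewrite /base_letters.
- exact: up.
- by rewrite cat_uniq up /= ub !mem_letters /= andbT PB.
- by rewrite cat_uniq up PB ub.
- by rewrite cat_uniq up PB ub.
- by case: (i == 1%N).
Qed.

Lemma row_letters_uniq X i : (1 <= i <= nrows X)%N ->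
  uniq (Plain i :: row_letters X i).
Proof.
move=> ir /=; apply/andP; split.
  rewrite mem_cat mem_base_letters // negb_or; apply/andP; split.
    by case: X ir => [r|r|r|r|] //=; lia.
  by case: has_redundant.
rewrite cat_uniq base_letters_uniq /=; case: ifP => //= red.
by rewrite orbF redundant_notin_base.
Qed.

(* Row i of a tableau when the row below has n boxes. *)
Definition row_word (X : cartanType) (i n : nat) (c : letter -> nat) : seq letter :=
  nseq n.+1 (Plain i) ++ flatten [seq nseq (c x) x | x <- row_letters X i].

Definition row_condition (X : cartanType) (i : nat) (c : letter -> nat) : bool :=
  match X with
  | TypeB _ => c Zero <= 1
  | TypeD r => (c (Plain r) == 0) || (c (Barred r) == 0)
  | TypeG2 => (i == 1) ==> (c Zero <= 1)
  | _ => true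
  end%N.

Lemma eq_row_word X i n c c' : {in row_letters X i, c =1 c'} ->
  row_word X i n c = row_word X i n c'.
Proof.
move=> cc; congr (_ ++ flatten _).
by apply/eq_in_map => x xF; rewrite cc.
Qed.

Lemma mem_row_word X i n c x : x \in row_word X i n c ->
  x = Plain i \/ x \in row_letters X i.
Proof.
rewrite mem_cat mem_nseq => /orP[/andP[_ /eqP]|]; first by left.
by case/flattenP => _ /mapP[y yF ->]; rewrite mem_nseq => /andP[_ /eqP ->]; right.
Qed.

Lemma count_row_word X i n c x : (1 <= i <= nrows X)%N ->
  count_mem x (row_word X i n c)
    = ((x == Plain i) * n.+1 + (x \in row_letters X i) * c x)%N.
Proof.
move=> ir; have /= /andP[_ uF] := row_letters_uniq ir.
by rewrite count_cat count_nseq count_flatten_nseq //= [Plain i == x]eq_sym mulnS addnA.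
Qed.

Lemma row_word_sorted X i n c : valid_type X -> (1 <= i <= nrows X)%N ->
  sorted tle (row_word X i n c).
Proof.
move=> Xr ir; rewrite sorted_pairwise; last exact: tle_trans.
pose d x := if x == Plain i then n.+1 else c x.
have := pairwise_flatten_nseq d tle_refl (row_letters_sorted Xr ir).
rewrite /= {1}/d eqxx; congr (pairwise _ (_ ++ flatten _)).
apply/eq_in_map => x xF; rewrite /d; case: eqP => // xi.
by have /= := row_letters_uniq ir; rewrite -xi xF.
Qed.

(** Since [tle] is antisymmetric, two sorted words with the same letter counts coincide. The
    predecessor compensates the extra box i that [row_word] puts in front. *)
Lemma row_word_unique X i w : valid_type X -> (1 <= i <= nrows X)%N ->
  (0 < count_mem (Plain i) w)%N -> sorted tle w ->
  (forall x, x \in w -> x = Plain i \/ x \in row_letters X i) ->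
  w = row_word X i (count_mem (Plain i) w).-1 (fun x => count_mem x w).
Proof.
move=> Xr ir wi ws wF; apply: (sorted_eq tle_trans tle_anti) => //.
  exact: row_word_sorted.
apply/allP => x _; apply/eqP.
have /= /andP[iF _] := row_letters_uniq ir.
transitivity ((x == Plain i) * (count_mem (Plain i) w).-1.+1
  + (x \in row_letters X i) * count_mem x w)%N;
  last exact: (esym (count_row_word _ _ _ ir)).
rewrite prednK //.
case: (eqVneq x (Plain i)) => [->|xi]; first by rewrite (negPf iF) mul1n addn0.
case: (boolP (x \in row_letters X i)) => [_|xF]; first by rewrite mul1n.
apply/count_memPn; apply: contraNN xF => /wF[xE|//].
by rewrite xE eqxx in xi.
Qed.

Lemma Plain1_notin_row X i x : valid_type X -> (1 <= i <= nrows X)%N ->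
  x \in row_letters X i -> x != Plain 1.
Proof.
move=> Xr ir; rewrite mem_row_letters //.
by case: X x Xr ir => [r|r|r|r|] [k||k] //= Xr ir; rewrite eq_letters; lia.
Qed.

(** Here [y] is the letter just before [w], so a run is counted at its first letter. *)
Fixpoint run_starts (y : letter) (w : seq letter) : nat :=
  if w is x :: w' then ((x != Plain 1) && (y != x) + run_starts x w')%N else 0%N.

Lemma row_segmentsE i w : row_segments i (Plain i :: w) = run_starts (Plain i) w.
Proof.
rewrite /row_segments big_ord_recl /= eqxx !andbF add0n.
elim: w (Plain i) => [|x w IHw] y; first by rewrite big_ord0.
rewrite big_ord_recl /= IHw andbT; congr (_ + _)%N.
Qed.

Lemma run_starts_nseq y n x w : run_starts y (nseq n x ++ w)
  = if n == 0%N then run_starts y w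
    else ((x != Plain 1) && (y != x) + run_starts x w)%N.
Proof.
elim: n y => //= n IHn y; rewrite IHn eqxx andbF add0n.
by rewrite if_same.
Qed.

Lemma run_starts_flatten (s : seq letter) c y : uniq (y :: s) ->
  Plain 1 \notin s ->
  run_starts y (flatten [seq nseq (c x) x | x <- s])
    = (\sum_(x <- s) (c x != 0))%N.
Proof.
elim: s y => [|x s IHs] y; first by rewrite big_nil.
rewrite /= !inE !negb_or => /andP[/andP[yx ys] /andP[xs us]] /andP[x1 s1].
rewrite run_starts_nseq big_cons; case: (eqVneq (c x) 0%N) => [_|_] /=.
  by rewrite IHs //= ys.
by rewrite yx eq_sym x1 IHs //= xs.
Qed.

Lemma row_segments_row_word X i n c : valid_type X -> (1 <= i <= nrows X)%N ->
  row_segments i (row_word X i n c)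
    = (\sum_(x <- row_letters X i) (c x != 0))%N.
Proof.
move=> Xr ir; rewrite /row_word /= row_segmentsE run_starts_nseq eqxx andbF.
rewrite if_same add0n run_starts_flatten //; last first.
  by apply/negP => /(Plain1_notin_row Xr ir); rewrite eqxx.
exact: row_letters_uniq.
Qed.

(** * Membership in T(infinity), row by row *)

(** Marginal largeness gives the number of boxes i. A sorted row beginning with i has no smaller
    letter, and the alphabet together with the type condition bounds its letters from above. *)
Lemma Tinf_row X T i : valid_type X -> Tinf X T -> (1 <= i <= nrows X)%N ->
  let w := trow T i in
  w = row_word X i (size (trow T i.+1)) (fun x => count_mem x w)
  /\ row_condition X i (fun x => count_mem x w).
Proof.
move=> Xr [[Talph _ Tsort _] Tml Tsize Thead Ttype] ir w.
rewrite -Tsize in ir.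
have iT : (i.-1 < size T)%N by lia.
have wT : w \in T by apply: mem_nth.
have wsort : sorted tle w.
  by apply: sub_sorted (allP Tsort _ wT) => x y; apply: preceq_tle.
have wcount := Tml _ ir; rewrite -/w in wcount.
have [w' wE] : exists w', w = Plain i :: w'.
  by have := Thead _ ir; rewrite -/w; case: (w) => //= x w' [->]; exists w'.
have wmin x : x \in w -> tle (Plain i) x.
  move: wsort; rewrite wE inE /= => /(order_path_min tle_trans)/allP w'min.
  by move=> /orP[/eqP ->|/w'min//]; apply: tle_refl.
rewrite Tsize in ir.
have i0 : (1 <= i <= size T)%N by rewrite Tsize.
split.
  rewrite {1}(row_word_unique Xr ir (w := w)) ?wcount // => x xw.
  have [->|xi] := eqVneq x (Plain i); [by left|right].
  rewrite mem_row_letters //.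
  have := wmin x xw; have := allP (allP Talph w wT) x xw; move: xi; rewrite tleE.
  case: X Xr ir Ttype {Tsort Talph Tsize} => [r|r|r|r|] /= Xr ir Ttype.
  - by case: x {xw} => [k||k] //; rewrite ?eq_letters; lia.
  - case: Ttype => /(_ i x i0 xw)/preceq_tle + _; rewrite tleE.
    by case: x {xw} => [k||k] //; rewrite ?eq_letters; lia.
  - have := Ttype i x i0 xw => /preceq_tle; rewrite tleE.
    by case: x {xw} => [k||k] //; rewrite ?eq_letters; lia.
  - case: Ttype => /(_ i x i0 xw)/preceq_tle + _; rewrite tleE.
    by case: x {xw} => [k||k] //; rewrite ?eq_letters; lia.
  - have [i1|i1] := boolP (i == 1%N).
      by case: x {xw} => [k||k] //; rewrite ?eq_letters; lia.
    have i2 : i = 2%N by lia.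
    case: Ttype => _ [n w2]; move: xw; rewrite /w i2 w2 inE mem_nseq.
    by case/orP => [/eqP->|/andP[_ /eqP->]].
case: X Xr ir Ttype {Tsort Talph Tsize} => [r|r|r|r|] //= Xr ir Ttype.
- by case: Ttype => _; apply.
- case: Ttype => _ /(_ w wT); rewrite negb_and => /orP[] /count_memPn ->.
    by rewrite eqxx.
  by rewrite eqxx orbT.
- by apply/implyP => /eqP i1; case: Ttype => + _; rewrite /w i1.
Qed.

Lemma Tinf_of_rows X T : valid_type X -> size T = nrows X ->
  (forall i, (1 <= i <= nrows X)%N -> let w := trow T i in
     w = row_word X i (size (trow T i.+1)) (fun x => count_mem x w)
     /\ row_condition X i (fun x => count_mem x w)) ->
  Tinf X T.
Proof.
move=> Xr Tsize Trow.
have Tout i : (nrows X < i)%N -> trow T i = [::].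
  by move=> ir; rewrite /trow nth_default // Tsize; lia.
have rowE i : (1 <= i)%N -> (i <= nrows X)%N ->
    exists w', trow T i = Plain i :: w'.
  move=> i1 ir; have [-> _] := Trow i (introT andP (conj i1 ir)).
  by rewrite /row_word /=; eexists.
have memT w : w \in T -> exists2 i, (1 <= i <= nrows X)%N & w = trow T i.
  by move=> /(nthP [::])[j jT <-]; exists j.+1 => //; rewrite -Tsize.
have memrow i x : (1 <= i <= nrows X)%N -> x \in trow T i ->
    x = Plain i \/ in_row X i x.
  move=> ir; have [-> _] := Trow i ir => /mem_row_word[->|]; [by left|right].
  by rewrite -(mem_row_letters _ Xr ir).
have inalph i x : (1 <= i <= nrows X)%N -> x \in trow T i -> in_alphabet X x.
  move=> ir /(memrow _ _ ir)[->|].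
    by case: X Xr ir {Tsize Trow Tout rowE memT memrow} => [r|r|r|r|] /=; lia.
  by case: X Xr ir {Tsize Trow Tout rowE memT memrow} => [r|r|r|r|];
    case: x => [k||k] //=; lia.
have bounded i x : (if X is (TypeB _ | TypeC _ | TypeD _) then true else false) ->
    (1 <= i <= size T)%N -> x \in trow T i -> preceq X x (Barred i).
  move=> XB; rewrite Tsize => ir /(memrow _ _ ir) xi.
  rewrite /preceq; case: X Xr ir XB xi {Tsize Trow Tout rowE memT memrow inalph}
    => [r|r|r|r|] //= Xr ir _ [->|]; rewrite ?eq_letters /=; try lia;
    by case: x => [k||k] //=; rewrite ?eq_letters; lia.
split=> //.
- split.
  + by apply/allP => w /memT[i ir ->]; apply/allP => x; apply: inalph.
  + move=> i i1; have [ir|ir] := leqP i (nrows X); last by rewrite !Tout //; lia.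
    have [-> _] := Trow i (introT andP (conj i1 ir)).
    by rewrite size_cat size_nseq; lia.
  + apply/allP => w /memT[i ir ->].
    have [wE wc] := Trow i ir.
    have : sorted tle (trow T i) by rewrite wE; apply: row_word_sorted.
    apply: sub_in_sorted (allss _) => x y xw yw xy.
    (* The two orders differ only at r and bar r in type D, and [row_condition] keeps one of these
       letters out of the row. *)
    apply: tle_preceq xy _ => r XD [xE yE]; move: wc; rewrite XD /=.
    rewrite xE in xw; rewrite yE in yw.
    move=> /orP[/eqP|/eqP]; rewrite -?XD; move/count_memPn; by rewrite ?xw ?yw.
  (* The leading boxes i outnumber the boxes of row i+1, so the entry above any box of that row is
     i. *)
  + move=> i j i1; have [ir|ir] := leqP i.+1 (nrows X); last by rewrite Tout.
    move=> ji; have [-> _] := Trow i (introT andP (conj i1 (ltnW ir))).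
    rewrite nth_cat size_nseq (leqW ji) nth_nseq (leqW ji).
    have : nth Zero (trow T i.+1) j \in trow T i.+1 by apply: mem_nth.
    move=> /(memrow i.+1 _ ir)[->|]; first by rewrite /=.
    move: (nth _ _ _) => x.
    by case: X Xr ir {Tsize Trow Tout rowE memT memrow inalph bounded} => [r|r|r|r|];
      case: x => [k||k] //=; lia.
- move=> i; rewrite Tsize => ir; have [-> _] := Trow i ir.
  rewrite count_row_word // eqxx mul1n.
  by have /= /andP[/negPf -> _] := row_letters_uniq ir; rewrite addn0.
- by move=> i; rewrite Tsize => /andP[i1 ir]; have [w' ->] := rowE i i1 ir.
- have Trow1 := Trow; rewrite /type_condition.
  case: X Xr Tsize Trow bounded memT {Tout rowE memrow inalph Trow1}
    => [r|r|r|r|] //= Xr Tsize Trow bounded memT.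
  + split; first by move=> i x; apply: bounded.
    by move=> w /memT[i ir ->]; have [_] := Trow i ir.
  + by move=> i x; apply: bounded.
  + split; first by move=> i x; apply: bounded.
    move=> w /memT[i ir ->]; have [_] := Trow i ir.
    by rewrite negb_and => /orP[] /eqP/count_memPn ->; rewrite ?orbT.
  + split; first by have [_] := Trow 1%N isT.
    have [-> _] := Trow 2%N isT.
    have -> : trow T 3 = [::] by rewrite /trow nth_default // Tsize.
    by rewrite /row_word /= cats0; eexists.
Qed.

(** * Tableaux and multiplicities of the positive roots *)

Definition mult (X : cartanType) (i : nat) (c : letter -> nat) (x : letter) : nat :=
  (c x + (x \in absorbing X i) * (absorbed X * c (Barred i)))%N.

(** The inverse of [mult] extracts as many boxes bar i as possible. What remains is at most one 0,
    or in type D at most one of the letters r and bar r, which is exactly [row_condition]. *)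
Definition unmult (X : cartanType) (i : nat) (m : letter -> nat) (x : letter) : nat :=
  match X with
  | TypeB _ => if x == Barred i then (m Zero)./2
               else if x == Zero then nat_of_bool (odd (m Zero)) else m x
  | TypeG2 => if i != 1 then m x else if x == Barred 1 then (m Zero)./2
              else if x == Zero then nat_of_bool (odd (m Zero)) else m x
  | TypeD r => let n := minn (m (Plain r)) (m (Barred r)) in
               if x == Barred i then n
               else if (x == Plain r) || (x == Barred r) then m x - n else m x
  | _ => m x
  end%N.

Lemma unmult_condition X i m : valid_type X -> (1 <= i <= nrows X)%N ->
  row_condition X i (unmult X i m).
Proof.
case: X => [r|r|r|r|] //= Xr ir.
- by case: odd.
- by rewrite !eq_letters !eqxx /= ifF; lia.
- by case: eqP => //= _; case: odd.
Qed.

Lemma unmultK X i m x : valid_type X -> (1 <= i <= nrows X)%N ->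
  x \in base_letters X i -> mult X i (unmult X i m) x = m x.
Proof.
move=> Xr ir; rewrite mem_base_letters // /mult.
case: X Xr ir => [r|r|r|r|] Xr ir;
  rewrite /absorbing /unmult /absorbed ?mul0n ?addn0 //.
- rewrite inE; case: x => [k||k] xr; rewrite ?eq_letters ?mul0n ?addn0 ?eqxx //.
    by rewrite mul1n mul2n odd_double_half.
  by move: xr; rewrite /= => xr; rewrite ifF //; lia.
- rewrite !inE ?eq_letters eqxx.
  case: x => [k||k] /= xr; rewrite ?eq_letters ?orbF //=.
    by case: (eqVneq k r) => [->|_] /=; lia.
  rewrite (_ : (k == i) = false); last lia.
  by case: (eqVneq k r) => [->|_] /=; lia.
- case: (eqVneq i 1%N) => [->|_]; rewrite ?mul0n ?addn0 // inE eqxx.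
  case: x => [k||k] /= xr; rewrite ?eq_letters ?mul0n ?addn0 //=.
    by rewrite mul1n mul2n odd_double_half.
  by rewrite ifF //; lia.
Qed.

Lemma multK X i c x : valid_type X -> (1 <= i <= nrows X)%N ->
  row_condition X i c -> x \in row_letters X i ->
  unmult X i (mult X i c) x = c x.
Proof.
move=> Xr ir; rewrite mem_row_letters //.
have halfE a b : (a <= 1 -> (a + 2 * b)./2 = b)%N by lia.
have oddE a b : (a <= 1 -> odd (a + 2 * b) = a :> nat)%N by lia.
case: X Xr ir => [r|r|r|r|] Xr ir;
  rewrite /mult /unmult /absorbing /absorbed ?mul0n ?addn0 //.
- move=> /= c0 xr; rewrite !inE ?eq_letters ?eqxx ?mul1n.
  have [->|xb] := eqVneq x (Barred i); first exact: halfE.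
  have [->|xz] := eqVneq x Zero; first exact: oddE.
  by rewrite mul0n addn0.
- rewrite !inE ?eq_letters ?eqxx /= ?mul1n => c0 xr.
  have [->|xb] := eqVneq x (Barred i); first by lia.
  have [->|xp] := eqVneq x (Plain r); first by rewrite /=; lia.
  have [->|xq] := eqVneq x (Barred r); first by rewrite /=; lia.
  by rewrite /= mul0n addn0.
- have [->|i1] := eqVneq i 1%N; rewrite ?mul0n ?addn0 // => /= c0 xr.
  rewrite !inE ?eq_letters ?eqxx ?mul1n.
  have [->|xb] := eqVneq x (Barred 1); first exact: halfE.
  have [->|xz] := eqVneq x Zero; first exact: oddE.
  by rewrite mul0n addn0.
Qed.

Lemma absorbing_base X i : valid_type X -> (1 <= i <= nrows X)%N ->
  {subset absorbing X i <= base_letters X i}.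
Proof.
move=> Xr ir x; rewrite mem_base_letters //.
case: X Xr ir => [r|r|r|r|] //= Xr ir; rewrite ?inE.
- by move=> /eqP ->; lia.
- by move=> /orP[] /eqP -> /=; lia.
- by case: eqP => // -> /=; rewrite inE => /eqP ->.
Qed.

Lemma eq_unmult X i m m' : valid_type X -> (1 <= i <= nrows X)%N ->
  {in base_letters X i, m =1 m'} ->
  {in row_letters X i, unmult X i m =1 unmult X i m'}.
Proof.
move=> Xr ir mm x; rewrite mem_cat => xF.
have ma y : y \in absorbing X i -> m y = m' y.
  by move=> ya; apply/mm/(absorbing_base Xr ir).
have mx : x != Barred i -> m x = m' x.
  move=> xi; apply: mm; case/orP: xF => //.
  by case: ifP => // _; rewrite inE (negPf xi).
have mx' : ~~ has_redundant X i -> m x = m' x.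
  by move=> /negPf red; apply: mm; move: xF; rewrite red orbF.
case: X Xr ir ma mx mx' {mm xF} => [r|r|r|r|] //= Xr ir ma mx mx'; try exact: mx'.
- by rewrite ma ?mem_head //; case: eqP => // /eqP xi; rewrite mx.
- rewrite (ma (Plain r)) ?(ma (Barred r)) ?inE ?eqxx ?orbT //.
  by case: eqP => // /eqP xi; rewrite mx.
- case: (eqVneq i 1%N) ma mx mx' => [->|i1] ma mx mx' /=; last exact: mx'.
  rewrite ma ?mem_head //; case: eqP => // /eqP xi.
  by rewrite mx.
Qed.

(** The rows are built from the bottom, because the initial block of a row depends on the length of
    the row below; the default of [head] makes that length 0 below the last row. *)
Fixpoint build_rows (X : cartanType) (m : nat -> letter -> nat) (i k : nat) :
    tableau :=
  if k is k'.+1 then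
    let T := build_rows X m i.+1 k' in
    row_word X i (size (head [::] T)) (unmult X i (m i)) :: T
  else [::].

Lemma size_build_rows X m i k : size (build_rows X m i k) = k.
Proof. by elim: k i => //= k IHk i; rewrite IHk. Qed.

Lemma nth_build_rows X m i k j : (j < k)%N ->
  nth [::] (build_rows X m i k) j
    = row_word X (i + j) (size (nth [::] (build_rows X m i k) j.+1))
        (unmult X (i + j) (m (i + j)%N)).
Proof.
elim: k i j => // k IHk i [_|j jk]; first by rewrite addn0 /= nth0.
by rewrite /= IHk // addSnnS.
Qed.

Definition tableau_of (X : cartanType) (m : nat -> letter -> nat) : tableau :=
  build_rows X m 1 (nrows X).

Lemma trow_tableau_of X m i : (1 <= i <= nrows X)%N ->
  trow (tableau_of X m) i
    = row_word X i (size (trow (tableau_of X m) i.+1)) (unmult X i (m i)).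
Proof.
case: i => // i ir; rewrite /trow [LHS]nth_build_rows // add1n //.
Qed.

Lemma count_tableau_of X m i x : valid_type X -> (1 <= i <= nrows X)%N ->
  x \in row_letters X i ->
  count_mem x (trow (tableau_of X m) i) = unmult X i (m i) x.
Proof.
move=> Xr ir xF; rewrite trow_tableau_of // count_row_word // xF mul1n.
have /= /andP[iF _] := row_letters_uniq ir.
by case: eqP xF iF => [-> ->|].
Qed.

Lemma eq_row_condition X i c c' : valid_type X -> (1 <= i <= nrows X)%N ->
  {in row_letters X i, c =1 c'} -> row_condition X i c = row_condition X i c'.
Proof.
move=> Xr ir cc.
have ca y : y \in absorbing X i -> c y = c' y.
  by move=> /(absorbing_base Xr ir) yb; apply: cc; rewrite mem_cat yb.
case: X Xr ir ca {cc} => [r|r|r|r|] //= Xr ir ca.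
- by rewrite ca ?mem_head.
- by rewrite (ca (Plain r)) ?(ca (Barred r)) ?inE ?eqxx ?orbT.
- by case: eqP ca => //= _ ca; rewrite ca ?mem_head.
Qed.

Lemma Tinf_tableau_of X m : valid_type X -> Tinf X (tableau_of X m).
Proof.
move=> Xr; apply: Tinf_of_rows => // [|i ir w]; first exact: size_build_rows.
have cw : {in row_letters X i, unmult X i (m i) =1 (fun x => count_mem x w)}.
  by move=> x xF; rewrite /w count_tableau_of.
split; first by rewrite {1}/w trow_tableau_of //; apply: eq_row_word.
by rewrite -(eq_row_condition Xr ir cw) unmult_condition.
Qed.

Definition row_mult (X : cartanType) (T : tableau) (i : nat) : letter -> nat :=
  mult X i (fun x => count_mem x (trow T i)).

Lemma row_mult_tableau_of X m i x : valid_type X -> (1 <= i <= nrows X)%N ->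
  x \in base_letters X i -> row_mult X (tableau_of X m) i x = m i x.
Proof.
move=> Xr ir xb; rewrite -[RHS](unmultK (m i) Xr ir xb) /row_mult /mult.
rewrite count_tableau_of // ?mem_cat ?xb //; congr (_ + _)%N.
case: (boolP (x \in absorbing X i)) => [xa|_]; last by rewrite !mul0n.
rewrite count_tableau_of // mem_cat (_ : has_redundant X i) ?mem_head ?orbT //.
by case: X Xr ir xa {xb} => [r|r|r|r|] //= _ _; case: eqP.
Qed.

(** Induction from below the last row upwards: the length of row i+1 fixes the boxes i of row i, and
    the multiplicities fix its other letters. *)
Lemma row_mult_inj X T T' : valid_type X -> Tinf X T -> Tinf X T' ->
  (forall i x, (1 <= i <= nrows X)%N -> x \in base_letters X i ->
     row_mult X T i x = row_mult X T' i x) -> T = T'.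
Proof.
move=> Xr TX TX' TT.
have sT : size T = nrows X by case: TX.
have sT' : size T' = nrows X by case: TX'.
suff rowE k i : (1 <= i)%N -> (nrows X <= k + i.-1)%N -> trow T i = trow T' i.
  apply: (@eq_from_nth _ [::]) => [|j jT]; first by rewrite sT sT'.
  by apply: (rowE (nrows X) j.+1) => //; rewrite leq_addr.
elim: k i => [|k IHk] i i1 ik.
  by rewrite /trow !nth_default ?sT ?sT'.
have [ir|ir] := leqP i (nrows X); last by rewrite /trow !nth_default ?sT ?sT' //; lia.
have {}ir : (1 <= i <= nrows X)%N by rewrite i1.
have [wE c0] := Tinf_row Xr TX ir; have [wE' c0'] := Tinf_row Xr TX' ir.
rewrite wE wE' (IHk i.+1) //; last by rewrite /=; lia.
apply: eq_row_word => x xF; rewrite -(multK Xr ir c0 xF) -(multK Xr ir c0' xF).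
by apply: (eq_unmult Xr ir) xF => y yb; apply: TT.
Qed.

(** * Weight and segments in terms of multiplicities *)

Lemma big_absorbing (R : Type) (idx : R) (op : Monoid.com_law idx) X i
    (f : letter -> R) : valid_type X -> (1 <= i <= nrows X)%N ->
  \big[op/idx]_(x <- base_letters X i | x \in absorbing X i) f x
    = \big[op/idx]_(x <- absorbing X i) f x.
Proof.
move=> Xr ir; rewrite -big_filter; apply: perm_big; apply: uniq_perm.
- exact/filter_uniq/base_letters_uniq.
- by case: X {Xr ir} => [r|r|r|r|] //=; case: eqP.
- by move=> x; rewrite mem_filter; apply/andb_idr/absorbing_base.
Qed.

Lemma big_row_letters (R : Type) (idx : R) (op : Monoid.com_law idx) X i
    (f : letter -> R) :
  \big[op/idx]_(x <- row_letters X i) f x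
    = op (\big[op/idx]_(x <- base_letters X i) f x)
         (if has_redundant X i then f (Barred i) else idx).
Proof. by rewrite big_cat; case: ifP => _; rewrite ?big_seq1 ?big_nil. Qed.

Lemma sum_row_word (V : nmodType) X i n c (f : letter -> V) : f (Plain i) = 0 ->
  \sum_(x <- row_word X i n c) f x = \sum_(x <- row_letters X i) f x *+ c x.
Proof.
move=> f0; have sum_nseq k y : \sum_(x <- nseq k y) f x = f y *+ k.
  by elim: k => [|k IHk]; rewrite ?big_nil //= big_cons IHk mulrS.
rewrite big_cat sum_nseq f0 mul0rn /= add0r big_flatten big_map.
by apply: eq_bigr => x _; apply: sum_nseq.
Qed.

Lemma box_weight_Plain X i : valid_type X -> (1 <= i <= nrows X)%N ->
  box_weight X i (Plain i) = 0.
Proof.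
move=> Xr ir; apply/ffunP => j; rewrite box_weightE ffunE.
case: X Xr ir j => [r|r|r|r|] /= Xr ir j; try lia.
by have [->|->] : i = 1%N \/ i = 2%N by lia.
Qed.

Lemma box_weight_redundant X i : valid_type X -> (1 <= i <= nrows X)%N ->
  has_redundant X i ->
  \sum_(x <- absorbing X i) box_weight X i x *+ absorbed X
    = box_weight X i (Barred i).
Proof.
case: X => [r|r|r|r|] // Xr ir red; apply/ffunP => j.
- by rewrite big_seq1 Qplus_mulnE !box_weightE; rewrite /= in Xr ir *; lia.
- rewrite !big_cons big_nil addr0 !mulr1n Qplus_addE !box_weightE.
  by rewrite /= eqxx ifF; rewrite /= in Xr ir j *; lia.
- have i1 : i = 1%N by apply/eqP.
  rewrite i1 big_seq1 Qplus_mulnE !box_weightE /=; lia.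
Qed.

Lemma sum_box_weight_mult X i c : valid_type X -> (1 <= i <= nrows X)%N ->
  \sum_(x <- base_letters X i) box_weight X i x *+ mult X i c x
    = \sum_(x <- row_letters X i) box_weight X i x *+ c x.
Proof.
move=> Xr ir; rewrite big_row_letters.
transitivity (\sum_(x <- base_letters X i) (box_weight X i x *+ c x
    + box_weight X i x *+ ((x \in absorbing X i) * (absorbed X * c (Barred i))))).
  by apply: eq_bigr => x _; rewrite -mulrnDr.
rewrite big_split /=; congr (_ + _).
transitivity (\sum_(x <- base_letters X i | x \in absorbing X i)
    box_weight X i x *+ absorbed X *+ c (Barred i)).
  rewrite [RHS]big_mkcond /=; apply: eq_bigr => x _.
  by case: ifP => _; rewrite ?mul0n ?mul1n ?mulr0n // mulrnA.
rewrite big_absorbing // sumrMnl; case: ifP => [red|].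
  by rewrite box_weight_redundant.
by case: X Xr ir => [r|r|r|r|] //= _ _ /negbT; rewrite ?big_nil ?mul0rn //;
  case: eqP; rewrite // big_nil mul0rn.
Qed.

Lemma negwtE X T : valid_type X -> Tinf X T ->
  negwt X T = \sum_(k <- root_index X) box_weight X k.1 k.2 *+ row_mult X T k.1 k.2.
Proof.
move=> Xr TX; have sT : size T = nrows X by case: TX.
rewrite /root_index big_allpairs_dep /negwt sT /index_iota subn1 /=.
rewrite big_seq [RHS]big_seq; apply: eq_bigr => i.
rewrite mem_iota add1n ltnS => ir.
have [wE _] := Tinf_row Xr TX ir.
rewrite {1}wE sum_row_word ?box_weight_Plain //.
by rewrite -sum_box_weight_mult.
Qed.

Definition seg_excess (X : cartanType) (i : nat) (c : letter -> nat) : bool :=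
  match X with
  | TypeB _ => (c Zero != 0) && (c (Barred i) != 0)
  | TypeG2 => [&& i == 1, c Zero != 0 & c (Barred i) != 0]
  | _ => false
  end%N.

Definition seg_defect (X : cartanType) (i : nat) (c : letter -> nat) : bool :=
  match X with
  | TypeD r => [&& c (Barred i) != 0, c (Plain r) == 0 & c (Barred r) == 0]
  | _ => false
  end%N.

(** If bar i occurs, its replacement deletes one segment and creates one for each absorbing letter
    that was absent. In types B and G2 a segment is lost exactly when 0 was present. In type D
    [row_condition] leaves at least one of r and bar r absent, so a segment is gained exactly when
    both are. *)
Lemma row_seg_mult X i c : valid_type X -> (1 <= i <= nrows X)%N ->
  row_condition X i c ->
  (\sum_(x <- row_letters X i) (c x != 0) + seg_defect X i c
    = \sum_(x <- base_letters X i) (mult X i c x != 0) + seg_excess X i c)%N.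
Proof.
move=> Xr ir c0; rewrite big_row_letters /=.
have -> : (\sum_(x <- base_letters X i) (mult X i c x != 0)
    = \sum_(x <- base_letters X i) (c x != 0)
      + \sum_(x <- absorbing X i) ((c x == 0) && (c (Barred i) != 0)))%N.
  rewrite -big_absorbing // [X in (_ + X)%N]big_mkcond -big_split /=.
  apply: eq_bigr => x _; rewrite /mult.
  case: ifP => _; last by rewrite mul0n !addn0.
  by rewrite mul1n /absorbed; case: X {Xr ir c0} => *; case: (c x) => //=; lia.
rewrite -!addnA; congr (_ + _)%N.
case: X Xr ir c0 => [r|r|r|r|] //= Xr ir c0; rewrite ?big_nil // ?big_cons ?big_nil.
- lia.
- lia.
- by case: (i =P 1%N) c0 => [->|_] c0; rewrite ?big_cons ?big_nil /=; lia.
Qed.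

Lemma segE X T : valid_type X -> Tinf X T ->
  seg X T = (\sum_(k <- root_index X) (row_mult X T k.1 k.2 != 0%N))%N.
Proof.
move=> Xr TX; have sT : size T = nrows X by case: TX.
pose c i x := count_mem x (trow T i).
have memE i x : (x \in trow T i) = (c i x != 0%N).
  by rewrite -has_pred1 has_count lt0n.
have segE' : (seg' T + \sum_(i <- iota 1 (nrows X)) seg_defect X i (c i)
    = \sum_(k <- root_index X) (row_mult X T k.1 k.2 != 0%N)
      + \sum_(i <- iota 1 (nrows X)) seg_excess X i (c i))%N.
  rewrite /root_index big_allpairs_dep /seg' sT /index_iota subn1 /= -!big_split /=.
  rewrite big_seq [RHS]big_seq; apply: eq_bigr => i.
  rewrite mem_iota add1n ltnS => ir.
  have [wE wc] := Tinf_row Xr TX ir.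
  by rewrite {1}wE row_segments_row_word // row_seg_mult.
have rE (f : nat -> bool) :
    (\sum_(1 <= i < (size T).+1) f i = \sum_(i <- iota 1 (nrows X)) f i)%N.
  by rewrite sT /index_iota subn1.
have zE (s : seq nat) : (\sum_(i <- s) false = 0)%N by rewrite big1.
move: segE'; case: X Xr TX sT rE {memE} (memE) => [r|r|r|r|] Xr TX sT rE memE /=.
- by rewrite !zE !addn0.
- rewrite zE addn0 => ->; rewrite /e_B rE.
  under [X in (_ - X)%N]eq_bigr do rewrite !memE.
  by rewrite addnK.
- by rewrite !zE !addn0.
- rewrite zE addn0 => <-; rewrite /e_D rE.
  by under [X in (_ + X)%N = _]eq_bigr do rewrite !memE !negbK.
- rewrite !big_cons !big_nil /= !memE; lia.
Qed.

(** * Assembling the identity *)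

Lemma eq_has_formal_sum (r : nat) (I : choiceType) (D : set I)
    (f f' : I -> pseries r) s :
  (forall i, D i -> f i = f' i) -> has_formal_sum D f s -> has_formal_sum D f' s.
Proof.
move=> ff /has_formal_sumP fs; apply/has_formal_sumP => m.
have [l [ul lD fl sE]] := fs m; exists l; split=> // [i Di|].
  by rewrite -ff //; apply: fl.
by rewrite sE big_seq [RHS]big_seq; apply: eq_bigr => i /lD Di; rewrite ff.
Qed.

(** An iterated product over a set runs over the indices whose factor is not neutral, so this
    ensures that no positive root is dropped. The coefficient at z^a is 1 - t^-1, which takes the
    value 1 at t^-1 = 0. *)
Lemma factor_neq1 (r : nat) (a : Qplus r) : a != 0 ->
  psmul (pssub (psone r) (psmono tinv a)) (psgeom a) <> psone r.
Proof.
move=> a0 /(congr1 (fun f => f a)); rewrite psmul_subl.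
have -> : psmul (psone r) (psgeom a) a = 1.
  have := psmul_mono 1 0 (psgeom a) a; rewrite add0r mul1r => ->.
  by have := psgeom_mulrn 1 a0.
have -> : psmul (psmono tinv a) (psgeom a) a = tinv.
  have := psmul_mono tinv a (psgeom a) 0; rewrite addr0 => ->.
  by have := psgeom_mulrn 0 a0; rewrite mulr0n => ->; rewrite mulr1.
rewrite /psone /psmono (negPf a0) => /(congr1 (horner^~ 0)).
by rewrite /tinv !hornerE => /eqP; rewrite oner_eq0.
Qed.

(** Used to carry the given order of the positive roots over to the pairs (row, letter) that index
    them. *)
Lemma perm_map_lift (S T : eqType) (f : S -> T) (s : seq S) (t : seq T) :
  perm_eq t [seq f x | x <- s] ->
  exists2 s', perm_eq s' s & [seq f x | x <- s'] = t.
Proof.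
case: s => [|x0 s] st.
  by exists [::] => //; move: st => /perm_nilP ->.
have /(perm_iotaP (f x0))[Is Ip ->] := st; rewrite size_map in Ip.
exists [seq nth x0 (x0 :: s) i | i <- Is].
  by apply/(perm_iotaP x0); exists Is.
rewrite -map_comp; apply/eq_in_map => i; rewrite (perm_mem Ip) mem_iota => /andP[_ ilt].
by rewrite /= -(nth_map x0 (f x0)).
Qed.

Definition root_mults (X : cartanType) (K : seq (nat * letter)) (T : tableau) :
    seq nat :=
  [seq row_mult X T k.1 k.2 | k <- K].

Lemma root_mults_bij X K : valid_type X -> perm_eq K (root_index X) ->
  set_bij (Tinf X) [set c : seq nat | size c = size K]%classic (root_mults X K).
Proof.
move=> Xr KX.
have memK i x : ((i, x) \in K) = (1 <= i <= nrows X)%N && (x \in base_letters X i).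
  rewrite (perm_mem KX); apply/allpairsPdep/andP => [[j [y [+ ? [-> ->]]]]|[ir ?]].
    by rewrite mem_iota add1n ltnS.
  by exists i, x; rewrite mem_iota add1n ltnS.
split.
- by move=> T _; rewrite /= size_map.
- move=> T T'; rewrite !inE => TX TX' /eq_in_map TT.
  apply: (row_mult_inj Xr TX TX') => i x ir xb.
  by apply: (TT (i, x)); rewrite memK ir xb.
- move=> c /= cK; pose m i x := nth 0%N c (index (i, x) K).
  exists (tableau_of X m); first exact: Tinf_tableau_of.
  have uK : uniq K.
    rewrite (perm_uniq KX) allpairs_uniq_dep ?iota_uniq //.
      by move=> i _; apply: base_letters_uniq.
    by move=> [i x] [j y] _ _ /= [-> ->].
  apply: (@eq_from_nth _ 0%N) => [|n]; rewrite size_map // => nK.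
  have kK := mem_nth (0%N, Zero) nK.
  rewrite (nth_map (0%N, Zero)) //; move: kK.
  case kE: (nth (0%N, Zero) K n) => [i x]; rewrite memK => /andP[ir xb].
  by rewrite /= row_mult_tableau_of // /m -kE index_uniq.
Qed.

Theorem theorem0p2 (R : realType) (g : lieAlgebra R[i]%C) (H : {vspace g})
    (X : cartanType) (alpha : 'I_(rank X) -> hdual H) :
  valid_type X ->
  simple_lie g ->
  cartan_subalgebra H ->
  is_base alpha ->
  has_cartan_matrix alpha (cartan_entry X) ->
  has_formal_sum (Tinf X)
    (fun T => psmono ((1 - tinv) ^+ seg X T) (negwt X T))
    (\big[@psmul _ / psone _]_(a \in pos_roots alpha)
       psmul (pssub (psone _) (psmono tinv a)) (psgeom a)).
Proof.
move=> Xr _ cartH baseA cartA.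
rewrite (pos_rootsE Xr cartH baseA cartA).
set L := finite_support _ _ _.
pose wt (k : nat * letter) := box_weight X k.1 k.2.
have boxE a : box_roots X a <-> a \in [seq wt k | k <- root_index X].
  split=> [[i [x [ix ->]]]|/mapP[[i x] ix ->]].
    by apply/mapP; exists (i, x); rewrite ?mem_root_index.
  by exists i, x; rewrite -mem_root_index.
have box0 a : box_roots X a -> a != 0.
  by move=> [i [x [ix ->]]]; apply: box_root_neq0.
have LX : perm_eq L [seq wt k | k <- root_index X].
  apply: uniq_perm => [||a].
  - exact: finite_support_uniq.
  - rewrite map_inj_in_uniq.
      apply: allpairs_uniq_dep => [|i _|[i x] [j y] _ _ /= [-> ->] //].
        exact: iota_uniq.
      exact: base_letters_uniq.
    move=> [i x] [j y]; rewrite !mem_root_index => ix jy.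
    exact: box_weight_inj.
  - rewrite in_finite_support.
      apply/idP/idP => [|/boxE aX]; first by rewrite inE => -[/boxE].
      by rewrite inE; split=> //; apply/factor_neq1/box0.
    apply: sub_finite_set (finite_seq [seq wt k | k <- root_index X]).
    by move=> b [/boxE].
(* [K] lists the pairs (row, letter) in the order in which [L] lists their roots, so exponent lists
   along [L] are multiplicity lists along [K]. *)
have [K KX KL] := perm_map_lift LX.
have sKL : size L = size K by rewrite -KL size_map.
have L0 : all (predC1 0) L.
  by apply/allP => a; rewrite (perm_mem LX) => /boxE/box0.
have := prod_factor_formal_sum L0.
rewrite sKL => /(has_formal_sum_bij (root_mults_bij Xr KX)).
apply: eq_has_formal_sum => T TX /=; congr (psmono (_ ^+ _) _).
  rewrite segE // /root_mults count_map -sum1_count big_mkcond /=.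
  by rewrite (perm_big _ KX) /=; apply: eq_bigr => k _; case: eqP.
rewrite negwtE // -KL /root_mults -(perm_big _ KX) /=.
elim: K {KX KL sKL} => [|k K IHK] /=; rewrite ?big_nil // !big_cons.
by rewrite IHK.
Qed.
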